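(* Let $\beta\ge 0$, and consider the ferromagnetic Ising model on the three-slab graph with periodic boundary conditions in the vertical direction, $\tilde{\mathcal{G}}_3$, at inverse temperature $\beta$, with zero external field and interaction $1$ on every edge. Let $\mu_+,\mu_-$ be its Gibbs measures with plus and minus boundary conditions. Then, for each choice of sign $\pm$, $$R(\mathbf{c}^{\pm};\mu_{\pm})>0\quad\text{if and only if}\quad |M(\mu_{\pm})|>0 .$$
   Context: The graph $\tilde{\mathcal{G}}_3$ has vertex set $\mathbb{Z}^2\times\{0,1,2\}$. Its edges are all pairs of vertices at Euclidean distance one, together with all pairs $\langle(i,j,0),(i,j,2)\rangle$ with $i,j\in\mathbb{Z}$. Let $\Sigma^{(3)}=\{-1,+1\}^{\mathbb{Z}^2\times\{0,1,2\}}$ with the $\sigma$-field generated by finite-dimensional cylinders. The measure $\mu_\pm$ on $\Sigma^{(3)}$ is the weak limit, as the finite box $B\uparrow\mathbb{Z}^2$, of the finite-volume Ising measures on $\Lambda=B\times\{0,1,2\}$ with all spins outside $\Lambda$ equal to $\pm1$ and weights proportional to $\exp\{\beta\sum_{\langle x,y\rangle}\sigma_x\sigma_y\}$, the sum being over edges of $\tilde{\mathcal{G}}_3$ with at least one endpoint in $\Lambda$. Magnetization at the origin: $M(\mu_\pm)=\mathbb{E}_{\mu_\pm}(\sigma_{0,0,0})$. A $3$-vertex is a column $\mathbf{c}_{i,j}=((i,j,0),(i,j,1),(i,j,2))$ with $(i,j)\in\mathbb{Z}^2$. Two $3$-vertices $\mathbf{c}_{i,j},\mathbf{c}_{l,m}$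 are adjacent when $(i,j)$ and $(l,m)$ are adjacent in $\mathbb{Z}^2$. For $\sigma\in\Sigma^{(3)}$, a $(\mathbf{c}^+)$-cluster (respectively $(\mathbf{c}^-)$-cluster) of $\sigma$ is a maximal connected set of $3$-vertices $\mathbf{c}_{i,j}$ such that $\sum_{k=0}^{2}\sigma_{i,j,k}>0$ (respectively $<0$). The percolation probability is $$R(\mathbf{c}^\pm;\mu_\pm)=\mu_\pm(\{\sigma:\mathbf{c}_{0,0}\text{ belongs to an infinite }(\mathbf{c}^\pm)\text{-cluster of }\sigma\}),$$ with the same sign taken throughout. *)

(* Defs.v *)
From mathcomp Require Import all_boot all_order all_algebra.
From mathcomp Require Import all_classical all_reals all_analysis.

Set Implicit Arguments.
Unset Strict Implicit.
Unset Printing Implicit Defensive.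

Import Order.TTheory GRing.Theory Num.Theory.
Import numFieldNormedType.Exports.

Local Open Scope classical_set_scope.
Local Open Scope ring_scope.

Definition vertex : Type := (int * int * 'I_3)%type.

Definition origin : vertex := (0, 0, ord0).

(* Integer points are at Euclidean distance one iff at squared distance one. *)
Definition adj (x y : vertex) : bool :=
  let: (i, j, k) := x in
  let: (i', j', k') := y in
  ((i - i') ^+ 2 + (j - j') ^+ 2 + (k%:Z - k'%:Z) ^+ 2 == 1)
  || [&& i == i', j == j' &
         ((k == 0 :> nat) && (k' == 2 :> nat))
         || ((k == 2 :> nat) && (k' == 0 :> nat))].

(* [true] encodes +1 and [false] encodes -1, both for spins and for the choice
   of sign of the boundary condition. *)
Definition config : Type := vertex -> bool.

Definition spin {A : pzRingType} (b : bool) : A := if b then 1 else -1.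

Definition cylinders : set (set config) :=
  [set C | exists (F : seq vertex) (tau : config),
     C = [set sigma | forall x, x \in F -> sigma x = tau x]].

Definition Sigma3 := g_sigma_algebraType cylinders.

Section finite_volume.
Variable R : realType.

(* The box B = [a, b] x [c, d] of Z^2 is given by its corners (a, c), (b, d). *)
Definition box : Type := ((int * int) * (int * int))%type.

Definition in_box (B : box) : set (int * int) :=
  [set p | (B.1.1 <= p.1 <= B.2.1) && (B.1.2 <= p.2 <= B.2.2)].

Definition centered_box (n : nat) : box := ((- n%:Z, - n%:Z), (n%:Z, n%:Z)).

(* The filter of finite boxes B increasing to Z^2. *)
Definition boxes_to_Z2 : set_system box :=
  filter_from setT
    (fun n : nat => [set B | in_box (centered_box n) `<=` in_box B]).

Definition volume (B : box) : set vertex := [set x | in_box B x.1].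

(* Each edge {x, y} meeting the volume corresponds to the two ordered pairs
   (x, y) and (y, x), whence the factor 1/2. *)
Definition interaction (B : box) (sigma : config) : R :=
  2^-1 * \sum_(e \in [set e : vertex * vertex |
                       adj e.1 e.2 /\ (volume B e.1 \/ volume B e.2)])
           (spin (sigma e.1) * spin (sigma e.2) : R).

Definition weight (beta : R) (B : box) (sigma : config) : R :=
  expR (beta * interaction B sigma).

Definition bc_configs (s : bool) (B : box) : set config :=
  [set sigma | forall x, ~ volume B x -> sigma x = s].

(* Integral of f against the finite-volume Ising measure, which is carried by
   the finite set [bc_configs s B]. *)
Definition ising_expectation (beta : R) (s : bool) (B : box) (f : config -> R)
    : R :=
  (\sum_(sigma \in bc_configs s B) f sigma * weight beta B sigma)
  / (\sum_(sigma \in bc_configs s B) weight beta B sigma).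

(* [mu] is the weak limit, as B increases to Z^2, of the finite-volume Ising
   measures with boundary condition s. *)
Definition is_ising_state (beta : R) (s : bool) (mu : probability Sigma3 R)
    : Prop :=
  forall f : {ptws vertex -> bool} -> R,
    continuous f -> (exists M : R, forall sigma, `|f sigma| <= M) ->
    (ising_expectation beta s B f)%:E @[B --> boxes_to_Z2]
      --> ('E_mu[f : Sigma3 -> R])%E.

Definition magnetization (mu : probability Sigma3 R) : \bar R :=
  'E_mu[(fun sigma : Sigma3 => (spin (sigma origin) : R))]%E.

End finite_volume.

(* The column c_{i,j} is represented by its index (i, j). *)
Definition col_adj (c d : int * int) : bool :=
  (c.1 - d.1) ^+ 2 + (c.2 - d.2) ^+ 2 == 1.

Definition col_sum (sigma : config) (c : int * int) : int :=
  \sum_(k < 3) spin (sigma (c, k)).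

Definition signed_cols (s : bool) (sigma : config) : set (int * int) :=
  [set c | if s then 0 < col_sum sigma c else col_sum sigma c < 0].

Definition col_connected (C : set (int * int)) : Prop :=
  forall c d, C c -> C d ->
    exists p : seq (int * int),
      [/\ path col_adj c p, last c p = d & forall e, e \in p -> C e].

Definition is_cluster (s : bool) (sigma : config) (C : set (int * int)) : Prop :=
  [/\ C `<=` signed_cols s sigma, col_connected C &
      forall D, D `<=` signed_cols s sigma -> col_connected D ->
        C `<=` D -> D = C].

Definition percolates (s : bool) : set config :=
  [set sigma | exists C, [/\ is_cluster s sigma C, C (0, 0) & infinite_set C]].

Definition percolation_probability (R : realType) (s : bool)
  (mu : probability Sigma3 R) : \bar R := mu (percolates s).

(* Main.v *)
Require Import Defs.
From mathcomp Require Import all_boot all_order all_algebra.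
From mathcomp Require Import all_classical all_reals all_analysis.
From mathcomp Require Import zify ring lra.

(** Both properties concern the field of column signs: a column is plus when at
    least two of its three spins are plus ([majority]). This field is an
    increasing function of the spins, and flipping all spins flips it. The flip
    reduces minus boundary conditions to plus ones, so let mu be the plus state.

    Magnetization forces percolation ([magnetization_bound]). Explore, from the
    boundary of a box inwards, the plus columns joined to that boundary, together
    with their neighbours. If the origin stays unexplored, the unexplored region is
    surrounded by columns with at most one plus spin each, whatever these spins
    are. The cyclic shift of the three layers is an automorphism of the graph, and
    a column with at most one plus spin is mapped by the shift below its own flip.
    By monotonicity in the boundary condition, the mean of the spin of layer k + 1
    in the region is at most the opposite of the mean of the spin of layer k, so
    the column sum at the origin has mean at most 0 ([surrounded_column]). Hence
    the magnetization is at most the probability that the origin is joined to the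
    boundary of the box.

    Percolation forces magnetization ([percolation_magnetized]). If the
    magnetization vanishes, the plus and minus states coincide on local functions
    ([minus_limit]). The column field is then invariant under the flip and the
    symmetries of the square lattice, positively associated, uniformly mixing for
    increasing events, and boxes can be filled with plus columns at a bounded cost
    ([column_state_planar]). No field of this kind percolates ([no_percolation]):
    - by mixing, if the origin percolates with positive probability then large
      boxes are joined to far distances with probability near 1 ([zero_one]);
    - by positive association and symmetry, so is each of the eight half sides of
      a large box, by plus columns and, after a flip, by minus columns
      ([seven_arms_likely]);
    - three plus arms that alternate with minus arms around the box lie in three
      different plus clusters outside the box, by a planar argument on the parity
      of the crossings of a ray with the minus arms ([arms_separate]);
    - filling the box with plus columns makes it a trifurcation. By the
      Burton-Keane argument the number of disjoint trifurcation boxes in a large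
      box is at most the size of its boundary ([trifurcation_count]), while their
      mean number is of the order of its area.

    The correlation inequalities come from the four functions theorem
    ([four_functions]), and the finite-volume measures are handled through sums
    over one spin at a time ([conf_sum]), for which conditioning is the
    associativity of a composition ([gibbs_tower]). *)

Set Implicit Arguments.
Unset Strict Implicit.
Unset Printing Implicit Defensive.

Import Order.TTheory GRing.Theory Num.Theory.
Import numFieldNormedType.Exports.

Local Open Scope ring_scope.

Notation col := (int * int)%type.

(** * Paths of columns *)

Definition cnorm (c : col) : nat := maxn `|c.1|%N `|c.2|%N.

Lemma col_adjP (c d : col) :
  col_adj c d <->
  (c.1 = d.1 /\ (c.2 = d.2 + 1 \/ d.2 = c.2 + 1)) \/
  (c.2 = d.2 /\ (c.1 = d.1 + 1 \/ d.1 = c.1 + 1)).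
Proof.
case: c d => [a b] [a' b']; rewrite /col_adj /=; split.
  move=> /eqP h.
  have h1 : (a - a' = 0 \/ a - a' = 1 \/ a - a' = -1) by nia.
  have h2 : (b - b' = 0 \/ b - b' = 1 \/ b - b' = -1) by nia.
  case: h1 => [e1|[e1|e1]]; case: h2 => [e2|[e2|e2]]; rewrite e1 e2 in h;
    by [lia | exfalso; lia].
move=> h; apply/eqP.
case: h => -[-> [->|->]]; ring.
Qed.

Lemma col_adj_sym c d : col_adj c d -> col_adj d c.
Proof. by move=> /col_adjP h; apply/col_adjP; lia. Qed.

Lemma cnorm_adj c d : col_adj c d -> (cnorm d <= (cnorm c).+1)%N.
Proof. move=> /col_adjP; rewrite /cnorm; case: c d => [a b] [a' b'] /=; lia. Qed.

Definition conn (A : pred col) (x y : col) :=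
  exists p, [/\ path col_adj x p, last x p = y & all A (x :: p)].

Lemma conn_refl (A : pred col) x : A x -> conn A x x.
Proof. by move=> Ax; exists [::]; split => //=; rewrite Ax. Qed.

Lemma conn_edge (A : pred col) x y : A x -> A y -> col_adj x y -> conn A x y.
Proof. by move=> Ax Ay xy; exists [:: y]; split=> /=; rewrite ?xy ?Ax ?Ay. Qed.

Lemma conn_trans (A : pred col) y x z : conn A x y -> conn A y z -> conn A x z.
Proof.
move=> [p [pp lp ap]] [q [pq lq aq]]; exists (p ++ q); split.
- by rewrite cat_path pp lp pq.
- by rewrite last_cat lp.
- move: ap aq => /= /andP[-> ap] /andP[_ aq]; by rewrite all_cat ap aq.
Qed.

Lemma conn_ind (A : pred col) (P : col -> Prop) x y :
  conn A x y -> P x ->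
  (forall u v, A u -> A v -> col_adj u v -> P u -> P v) -> P y.
Proof.
move=> [p [pp <- ap]] Px step.
elim: p x pp ap Px => [//|z p IH] x /= /andP[xz pz] /and3P[Ax Az ap] Px.
by apply: IH => //=; [rewrite Az | apply: step Px].
Qed.

Lemma conn_in (A : pred col) x y : conn A x y -> A x /\ A y.
Proof.
move=> c; have Ax : A x by case: c => p [_ _ /andP[]].
by split=> //; apply: (conn_ind (P := A) c).
Qed.

Lemma conn_step (A : pred col) x y z :
  conn A x y -> A z -> col_adj y z -> conn A x z.
Proof.
move=> c Az yz; apply: conn_trans (c) _; apply: conn_edge => //.
by have [] := conn_in c.
Qed.

Lemma conn_sym (A : pred col) x y : conn A x y -> conn A y x.
Proof.
move=> c; have [Ax _] := conn_in c.
apply: (conn_ind (P := fun z => conn A z x) c); first exact: conn_refl.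
by move=> u v Au Av uv; apply: conn_trans; apply: conn_edge => //; apply: col_adj_sym.
Qed.

Lemma conn_sub (A B : pred col) x y :
  (forall z, A z -> B z) -> conn A x y -> conn B x y.
Proof.
move=> AB [p [pp lp ap]]; exists p; split=> //.
by apply: sub_all ap.
Qed.

Lemma conn_map (A B : pred col) (g : col -> col) x y :
  (forall u v, col_adj u v -> col_adj (g u) (g v)) ->
  (forall z, A z -> B (g z)) -> conn A x y -> conn B (g x) (g y).
Proof.
move=> gadj AB c; have [Ax _] := conn_in c.
apply: (conn_ind (P := fun z => conn B (g x) (g z)) c).
  exact/conn_refl/AB.
by move=> u v Au Av uv cu; apply: conn_step cu _ _; [exact: AB|exact: gadj].
Qed.

Lemma conn_exit (A B : pred col) x y : conn A x y -> B x -> ~~ B y ->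
  exists u v, [/\ conn (predI A B) x u, col_adj u v, ~~ B v & conn A v y].
Proof.
move=> [p [pp <- ap]].
elim: p x pp ap => [|z p IH] x /=; first by move=> _ _ ->.
move=> /andP[xz pz] /and3P[Ax Az ap] Bx nBy.
have [Bz|nBz] := boolP (B z).
  have [|u [v [c1 uv nBv c2]]] := IH z pz _ Bz nBy; first by rewrite /= Az.
  exists u, v; split=> //; apply: conn_trans c1.
  by apply: conn_edge => //=; rewrite ?Ax ?Az ?Bx ?Bz.
exists x, z; split=> //; first by apply: conn_refl; rewrite /= Ax Bx.
by exists p; split=> //=; rewrite Az.
Qed.

Lemma conn_vert (A : pred col) (x a b : int) : a <= b ->
  (forall k, a <= k <= b -> A (x, k)) -> conn A (x, a) (x, b).
Proof.
move=> ab; have -> : b = a + `|b - a|%N%:Z by lia.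
elim: `|b - a|%N => [|m IH] h; first by rewrite addr0; apply/conn_refl/h; lia.
apply: (@conn_step _ _ (x, a + m%:Z)).
- by apply: IH => k hk; apply: h; lia.
- by apply: h; lia.
- by apply/col_adjP => /=; lia.
Qed.

Lemma conn_horiz (A : pred col) (y a b : int) : a <= b ->
  (forall k, a <= k <= b -> A (k, y)) -> conn A (a, y) (b, y).
Proof.
move=> ab; have -> : b = a + `|b - a|%N%:Z by lia.
elim: `|b - a|%N => [|m IH] h; first by rewrite addr0; apply/conn_refl/h; lia.
apply: (@conn_step _ _ (a + m%:Z, y)).
- by apply: IH => k hk; apply: h; lia.
- by apply: h; lia.
- by apply/col_adjP => /=; lia.
Qed.

(** * Crossing parity of a ray *)

(** The ray starts at [v] displaced half a step to the left and goes up. The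
    displacement keeps the parity meaningful when [v] lies on the curve. *)
Definition edge_cross (v u w : col) : bool :=
  (v.2 <= u.2) && ((u.1 < v.1) != (w.1 < v.1)).

Fixpoint ray_parity (v x : col) (p : seq col) : bool :=
  if p is y :: q then edge_cross v x y (+) ray_parity v y q else false.

Definition on_ray (v u : col) : bool := (u.1 == v.1) && (v.2 <= u.2).

(** The rays from [v] and from the column above it differ by the edge between
    [v] and its left neighbour only. *)
Lemma ray_parity_up (v x : col) p : path col_adj x p ->
  v \notin x :: p \/ (v.1 - 1, v.2) \notin x :: p ->
  ray_parity (v.1, v.2 + 1) x p = ray_parity v x p.
Proof.
elim: p x => [//|y p IH] x /= /andP[/col_adjP xy pp] h.
rewrite IH //; last first.
  by case: h; rewrite inE negb_or => /andP[_ h]; [left|right].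
congr (_ (+) _); rewrite /edge_cross /=.
have {}h : v <> x /\ v <> y \/ (v.1 - 1, v.2) <> x /\ (v.1 - 1, v.2) <> y.
  case: h; rewrite !inE !negb_or => /and3P[/eqP h1 /eqP h2 _]; by [left|right].
case: v x y {pp IH} xy h => [v1 v2] [x1 x2] [y1 y2] /= xy h.
have {}h : (v1 = x1 /\ v2 = x2 \/ v1 = y1 /\ v2 = y2) ->
           (v1 - 1 = x1 /\ v2 = x2 \/ v1 - 1 = y1 /\ v2 = y2) -> False.
  case: h => -[h1 h2] k1 k2.
  - by case: k1 => -[e1 e2]; [apply: h1|apply: h2]; congr pair.
  - by case: k2 => -[e1 e2]; [apply: h1|apply: h2]; congr pair.
lia.
Qed.

(** Between the rays from [v] and from its right neighbour there is only the half
    column above [v]. A curve enters and leaves it by horizontal edges, which cross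
    one of the two rays, unless it uses the edge below [v] or has an end there. *)
Lemma ray_parity_right (v x : col) p : path col_adj x p ->
  v \notin x :: p \/ (v.1, v.2 - 1) \notin x :: p ->
  ray_parity (v.1 + 1, v.2) x p =
  ray_parity v x p (+) on_ray v x (+) on_ray v (last x p).
Proof.
elim: p x => [|y p IH] x /=.
  by move=> _ _; rewrite /on_ray; case: (_ && _).
move=> /andP[/col_adjP xy pp] h.
rewrite IH //; last first.
  by case: h; rewrite inE negb_or => /andP[_ h]; [left|right].
have -> : edge_cross (v.1 + 1, v.2) x y =
  edge_cross v x y (+) on_ray v x (+) on_ray v y; last first.
  by move: (edge_cross v x y) (on_ray v x) (on_ray v y) (on_ray v (last y p))
    (ray_parity v y p) => [] [] [] [] [].
rewrite /edge_cross /on_ray /=.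
have {}h : v <> x /\ v <> y \/ (v.1, v.2 - 1) <> x /\ (v.1, v.2 - 1) <> y.
  case: h; rewrite !inE !negb_or => /and3P[/eqP h1 /eqP h2 _]; by [left|right].
case: v x y {pp IH} xy h => [v1 v2] [x1 x2] [y1 y2] /= xy h.
have {}h : (v1 = x1 /\ v2 = x2 \/ v1 = y1 /\ v2 = y2) ->
           (v1 = x1 /\ v2 - 1 = x2 \/ v1 = y1 /\ v2 - 1 = y2) -> False.
  case: h => -[h1 h2] k1 k2.
  - by case: k1 => -[e1 e2]; [apply: h1|apply: h2]; congr pair.
  - by case: k2 => -[e1 e2]; [apply: h1|apply: h2]; congr pair.
lia.
Qed.

(** Every change of side happens above [v], so the crossings telescope. *)
Lemma ray_parity_below (v x : col) p : path col_adj x p ->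
  (forall c : col, c \in x :: p -> v.2 <= c.2) ->
  ray_parity v x p = ((x.1 < v.1) != ((last x p).1 < v.1)).
Proof.
elim: p x => [|y p IH] x /=; first by rewrite eqxx.
move=> /andP[_ pp] h; rewrite IH //; last by move=> c hc; apply: h; rewrite inE hc orbT.
rewrite /edge_cross h ?inE ?eqxx //=.
by case: (x.1 < _); case: (y.1 < _); case: ((last y p).1 < _).
Qed.

Lemma ray_parity_above (v x q : col) p : path col_adj x p ->
  (forall c : col, c \in x :: p -> v.2 <= c.2 -> c = q) -> ray_parity v x p = false.
Proof.
elim: p x => [//|y p IH] x /= /andP[/col_adjP xy pp] h.
rewrite IH //; last by move=> c hc; apply: h; rewrite inE hc orbT.
rewrite addbF /edge_cross; apply/negbTE/negP => /andP[vx ne].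
have ex := h x (mem_head _ _) vx.
have ey : y = q by apply: h; rewrite ?inE ?eqxx ?orbT //; lia.
by move: ne; rewrite ex ey eqxx.
Qed.

(** * Separation of arms around a box *)

Definition shell (n N : nat) : pred col := fun c => (n < cnorm c <= N)%N.

(** Prolonging an arm until it ends below the box keeps its end off every ray
    that starts in the box, since rays go up. *)
Lemma conn_to_bottom (N : nat) (u : col) : cnorm u = N ->
  exists2 z : col, z.2 < - N%:Z &
    conn (fun c => (c == u) || (N < cnorm c)%N) u z.
Proof.
case: u => a b; rewrite /cnorm /= => hN.
pose A : pred col := fun c => (c == (a, b)) || (N < cnorm c)%N.
suff : exists2 z : col, z.2 < - N%:Z & conn A (a, b) z by [].
have AuN c : (N < cnorm c)%N -> A c by rewrite /A => ->; rewrite orbT.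
have Au : A (a, b) by rewrite /A eqxx.
pose M : int := N%:Z + 1.
have down x : (`|x| = N.+1)%N -> conn A (x, b) (x, - M).
  move=> hx; apply: conn_sym; apply: conn_vert; first by rewrite /M; lia.
  by move=> k hk; apply: AuN; rewrite /cnorm /=; lia.
have [hb|hb] : b = - N%:Z \/ - N%:Z < b by lia.
  exists (a, b - 1) => /=; first by lia.
  apply: conn_edge => //; first by apply: AuN; rewrite /cnorm /=; lia.
  by apply/col_adjP => /=; lia.
have [ha|[ha|[ha hb']]] : a = - N%:Z \/ a = N%:Z \/ (`|a| < N)%N /\ b = N%:Z by lia.
- exists (a - 1, - M); first by rewrite /M /=; lia.
  apply: conn_trans (down _ _); last by lia.
  apply: conn_edge => //; first by apply: AuN; rewrite /cnorm /=; lia.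
  by apply/col_adjP => /=; lia.
- exists (a + 1, - M); first by rewrite /M /=; lia.
  apply: conn_trans (down _ _); last by lia.
  apply: conn_edge => //; first by apply: AuN; rewrite /cnorm /=; lia.
  by apply/col_adjP => /=; lia.
- exists (M, - M); first by rewrite /M /=; lia.
  apply: (@conn_trans _ (a, M)).
    apply: conn_edge => //; first by apply: AuN; rewrite /cnorm /M /=; lia.
    by apply/col_adjP; rewrite /M /=; lia.
  apply: (@conn_trans _ (M, M)).
    apply: conn_horiz; first by rewrite /M; lia.
    by move=> k hk; apply: AuN; rewrite /cnorm /M /=; lia.
  apply: conn_sym; apply: conn_vert; first by rewrite /M; lia.
  by move=> k hk; apply: AuN; rewrite /cnorm /M /=; lia.
Qed.

(** The two minus arms starting at [p] and [q], linked through the upper left corner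
    of the box of radius [n] and prolonged to the bottom, form a curve that no plus
    path of the shell meets. The parity of the crossings with the ray is thus
    constant along such a path. It differs between [t], which is cut off by the link,
    and the bottom of the box, whereas walking inside the box from the bottom to [s]
    does not change it. *)
Lemma arms_separate (A : pred col) (n N : nat) (p q t s u w : col) :
  (0 < n)%N ->
  p.1 = - n%:Z - 1 -> 0 <= p.2 <= n%:Z ->
  q.2 = n%:Z + 1 -> 0 <= q.1 <= n%:Z ->
  t.2 = n%:Z + 1 -> - n%:Z <= t.1 <= 0 ->
  cnorm u = N -> cnorm w = N ->
  conn (predI (predC A) (shell n N)) p u ->
  conn (predI (predC A) (shell n N)) q w ->
  conn (predI A (shell n N)) t s ->
  ~ ((s.1 = n%:Z + 1 /\ 0 <= s.2 <= n%:Z) \/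
     (s.2 = - n%:Z - 1 /\ 0 <= s.1 <= n%:Z)).
Proof.
move=> n0 p1 p2 q2 q1 t2 t1 uN wN cpu cqw cts.
have /andP[/= nAp shp] := (conn_in cpu).1.
have /andP[/= nAq shq] := (conn_in cqw).1.
have /andP[/= At sht] := (conn_in cts).1.
have /andP[/= As shs] := (conn_in cts).2.
have nN : (n < N)%N by move: sht; rewrite /shell; clear; lia.
(* the two arms, prolonged outside the box of radius N *)
pose O : pred col := fun c => (~~ A c && shell n N c) || (N < cnorm c)%N.
have toO c : predI (predC A) (shell n N) c -> O c by rewrite /O /= => ->.
have prolong x y : cnorm y = N -> conn (predI (predC A) (shell n N)) x y ->
    exists2 z : col, z.2 < - N%:Z & conn O x z.
  move=> yN cxy; have [z z2 cyz] := conn_to_bottom yN.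
  exists z => //; apply: (conn_trans (conn_sub toO cxy)).
  apply: conn_sub cyz => c /orP[/eqP->|cN]; last by rewrite /O cN orbT.
  exact: toO (conn_in cxy).2.
have [z1 z1l /conn_sym [g1 [pg1 lg1 ag1]]] := prolong _ _ uN cpu.
have [z2 z2l [g3 [pg3 lg3 ag3]]] := prolong _ _ wN cqw.
move=> {u w uN wN cpu cqw prolong toO}.
(* the link joining them inside the box, around its upper left corner *)
pose L : pred col := fun c => [|| c == p, c == q,
  (c.1 == - n%:Z) && (0 <= c.2 <= n%:Z) | (c.2 == n%:Z) && (- n%:Z <= c.1 <= n%:Z)].
have Lvert k : 0 <= k <= n%:Z -> L (- n%:Z, k).
  by move=> hk; rewrite /L /= eqxx hk !orbT.
have Lhoriz k : - n%:Z <= k <= n%:Z -> L (k, n%:Z).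
  by move=> hk; rewrite /L /= eqxx hk !orbT.
have Lp : L p by rewrite /L eqxx.
have Lq : L q by rewrite /L eqxx orbT.
have [g2 [pg2 lg2 ag2]] : conn L p q.
  apply: (@conn_trans _ (- n%:Z, p.2)).
    apply: conn_edge => //; first exact: Lvert.
    by apply/col_adjP => /=; clear - p1; lia.
  apply: (@conn_trans _ (- n%:Z, n%:Z)).
    apply: conn_vert; first by clear - p2; lia.
    by move=> k hk; apply: Lvert; clear - hk p2; lia.
  apply: (@conn_trans _ (q.1, n%:Z)).
    apply: conn_horiz; first by clear - q1; lia.
    by move=> k hk; apply: Lhoriz; clear - hk q1; lia.
  apply: conn_edge => //; first by apply: Lhoriz; clear - q1; lia.
  by apply/col_adjP => /=; clear - q2; lia.
have in1 c : c \in z1 :: g1 -> O c by move/(allP ag1).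
have in3 c : c \in q :: g3 -> O c by move/(allP ag3).
have in2 c : c \in p :: g2 -> L c by move/(allP ag2).
have notO c : (cnorm c <= n)%N -> ~~ O c by rewrite /O /shell => h; clear - h nN; lia.
have n1 c : ~~ O c -> c \notin z1 :: g1 by apply: contra => /in1.
have n3 c : ~~ O c -> c \notin q :: g3 by apply: contra => /in3.
have n2 c : ~~ L c -> c \notin p :: g2 by apply: contra => /in2.
pose phi v := ray_parity v z1 g1 (+) ray_parity v p g2 (+) ray_parity v q g3.
have phi_up (v : col) : ~~ O v -> ~~ L v \/ ~~ L (v.1 - 1, v.2) ->
    phi (v.1, v.2 + 1) = phi v.
  move=> hO hL; rewrite /phi !ray_parity_up //.
  - by left; apply: n3.
  - by case: hL => /n2; [left|right].
  - by left; apply: n1.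
have phi_right (v : col) : ~~ O v -> ~~ L v \/ ~~ L (v.1, v.2 - 1) ->
    - N%:Z <= v.2 -> phi (v.1 + 1, v.2) = phi v.
  move=> hO hL hv; rewrite /phi !ray_parity_right //.
  - rewrite lg1 lg2 lg3.
    have -> : on_ray v z1 = false by rewrite /on_ray; clear - hv z1l; lia.
    have -> : on_ray v z2 = false by rewrite /on_ray; clear - hv z2l; lia.
    move: (on_ray v p) (on_ray v q) (ray_parity v z1 g1) (ray_parity v p g2)
      (ray_parity v q g3) => [] [] [] [] []; done.
  - by left; apply: n3.
  - by case: hL => /n2; [left|right].
  - by left; apply: n1.
have phi_conn x y : conn (fun c => [&& ~~ O c, ~~ L c & - N%:Z <= c.2]) x y ->
    phi y = phi x.
  move=> c; apply: (conn_ind (P := fun v => phi v = phi x) c) => // a b.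
  move=> /and3P[Oa La ha] /and3P[Ob Lb hb] /col_adjP ab <-.
  case: ab => -[e [e'|e']].
  - have -> : a = (b.1, b.2 + 1) by case: a e e' {Oa La ha} => ? ? /= -> ->.
    by rewrite phi_up //; left.
  - have -> : b = (a.1, a.2 + 1) by case: b e e' {Ob Lb hb} => ? ? /= -> ->.
    by rewrite phi_up //; left.
  - have -> : a = (b.1 + 1, b.2) by case: a e e' {Oa La ha} => ? ? /= -> ->.
    by rewrite phi_right //; left.
  - have -> : b = (a.1 + 1, a.2) by case: b e e' {Ob Lb hb} => ? ? /= -> ->.
    by rewrite phi_right //; left.
have inA c : predI A (shell n N) c -> ~~ O c /\ ~~ L c.
  move=> /andP[Ac shc]; split.
    by rewrite /O; move: shc; rewrite /= Ac /shell; clear; lia.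
  rewrite /L !negb_or; apply/and4P; split.
  - by apply: contraNneq nAp => <-.
  - by apply: contraNneq nAq => <-.
  - by move: shc; rewrite /= /shell /cnorm; clear; lia.
  - by move: shc; rewrite /= /shell /cnorm; clear; lia.
have phits : phi s = phi t.
  apply: phi_conn; apply: conn_sub cts => c h; have [-> ->] := inA _ h.
  by move: h => /= /andP[_]; rewrite /shell /cnorm; clear; lia.
have [Ot Lt] := inA _ (conn_in cts).1.
have [Os Ls] := inA _ (conn_in cts).2.
pose b : col := (t.1, - n%:Z).
(* t and q have opposite signs, hence are different *)
have tq : t.1 < q.1.
  have : t.1 != q.1; last by clear - t1 q1; lia.
  apply: contraNneq nAq => e; suff -> : q = t by [].
  by case: (q) (t) q2 t2 e => ? ? [? ?] /= -> -> ->.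
have phibt : phi t = ~~ phi b.
  have r2t : ray_parity t p g2 = false.
    apply: (ray_parity_above (q := q)) => // c /in2 Lc hc.
    apply/eqP; move: Lc; rewrite /L => /or4P[/eqP ec|//|h|h]; exfalso.
    - by move: hc; rewrite ec => hc; clear - hc t2 p2; lia.
    - by clear - hc h t2; lia.
    - by clear - hc h t2; lia.
  have r2b : ray_parity b p g2 = true.
    rewrite ray_parity_below // ?lg2 /=; first by clear - p1 t1 tq; lia.
    move=> c /in2; rewrite /L => /or4P[/eqP->|/eqP->|h|h] /=.
    - by clear - p2; lia.
    - by clear - q2; lia.
    - by clear - h; lia.
    - by clear - h; lia.
  (* the arms do not enter the box, so they do not see the descent from t to b *)
  have colm (x : col) g : path col_adj x g ->
      (forall c, ~~ O c -> c \notin x :: g) -> ray_parity t x g = ray_parity b x g.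
    move=> pg hg; have -> : t = (t.1, - n%:Z + (n + n).+1%:Z).
      by case: (t) t2 => ? ? /= ->; congr pair; clear; lia.
    rewrite /b; have : ((n + n).+1 <= (n + n).+1)%N by [].
    elim: {1 3}((n + n).+1) => [|m IH] hm; first by rewrite addr0.
    rewrite -IH; last by clear - hm; lia.
    have -> : - n%:Z + m.+1%:Z = (- n%:Z + m%:Z) + 1 by clear; lia.
    rewrite (@ray_parity_up (t.1, - n%:Z + m%:Z)) //.
    by left; apply: hg; apply: notO; rewrite /cnorm /=; clear - hm t1; lia.
  rewrite /phi r2t r2b (colm z1 g1 pg1 n1) (colm q g3 pg3 n3).
  by case: ray_parity; case: ray_parity.
move=> sE; have phibs : phi s = phi b.
  have inner c : (cnorm c <= n)%N -> ~~ L c ->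
      [&& ~~ O c, ~~ L c & - N%:Z <= c.2].
    by move=> hc ->; rewrite notO //; move: hc; rewrite /cnorm; clear - nN; lia.
  have row (x : int) : 0 <= x <= n%:Z ->
      conn (fun c => [&& ~~ O c, ~~ L c & - N%:Z <= c.2]) b (x, - n%:Z).
    move=> hx; apply: conn_horiz; first by clear - hx t1; lia.
    move=> k hk; apply: inner; first by rewrite /cnorm /=; clear - hk hx t1; lia.
    rewrite /L !negb_or; apply/and4P; split; [| |by move=> /=; clear - n0; lia..].
    - by apply/eqP => e; move: (p1) (p2); rewrite -e /=; clear - hk hx t1 n0; lia.
    - by apply/eqP => e; move: (q2); rewrite -e /=; clear - n0; lia.
  case: sE => -[es hs].
    (* the walk stops below s.2, because the link may occupy the upper right corner *)
    pose v : col := (n%:Z, s.2 - 1).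
    have Lv : ~~ L v.
      rewrite /L !negb_or; apply/and4P; split; [| |by move=> /=; clear - hs n0; lia..].
      - by apply/eqP => e; move: (p1); rewrite -e /=; clear; lia.
      - by apply/eqP => e; move: (q2); rewrite -e /=; clear - hs; lia.
    have -> : phi b = phi v.
      symmetry; apply: phi_conn; apply: (conn_trans (row n%:Z _)); first by clear; lia.
      apply: conn_vert; first by clear - hs n0; lia.
      move=> k hk; apply: inner; first by rewrite /cnorm /=; clear - hk hs n0; lia.
      rewrite /L !negb_or; apply/and4P; split; [| |by move=> /=; clear - hk hs n0; lia..].
      - by apply/eqP => e; move: (p1); rewrite -e /=; clear; lia.
      - by apply/eqP => e; move: (q2); rewrite -e /=; clear - hk hs; lia.
    rewrite -(phi_up v) //; [| by apply: notO; rewrite /cnorm /=; clear - hs n0; lia | by left].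
    have -> : s = ((n%:Z, v.2 + 1).1 + 1, (n%:Z, v.2 + 1).2).
      by rewrite /v /=; case: (s) es => ? ? /= ->; congr pair; clear; lia.
    rewrite phi_right //=.
    - by apply: notO; rewrite /cnorm /=; clear - hs n0; lia.
    - by right; have -> : s.2 - 1 + 1 - 1 = s.2 - 1 by clear; lia.
    - by clear - hs nN; lia.
  rewrite -(phi_conn _ _ (row s.1 hs)) -(phi_up s) //; last by left.
  by congr phi; case: (s) es => ? ? /= ->; congr pair; clear; lia.
by move: phits; rewrite phibt phibs; case: (phi b).
Qed.

(** * Counting trifurcation boxes *)

Lemma conn_avoid (A B : pred col) x y :
  conn A x y -> (forall v, conn A x v -> B v) -> conn B x y.
Proof.
move=> c h; have [Ax _] := conn_in c.
have [_ //] : conn A x y /\ conn B x y.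
apply: (conn_ind (P := fun z => conn A x z /\ conn B x z) c).
  by split; apply: conn_refl => //; apply: h; apply: conn_refl.
move=> u v Au Av uv [c1 c2]; have c3 := conn_step c1 Av uv.
by split=> //; apply: (conn_step c2 _ uv); apply: h.
Qed.

(** The order of [Y] itself serves to choose among its columns. *)
Lemma ex_last_index (P : col -> Prop) (Y : seq col) y0 : y0 \in Y -> P y0 ->
  exists y, [/\ y \in Y, P y &
    forall y', y' \in Y -> P y' -> (index y' Y <= index y Y)%N].
Proof.
move=> y0Y Py0.
pose Q m := `[< exists y, [/\ y \in Y, P y & index y Y = m] >].
have exQ : exists m, Q m by exists (index y0 Y); apply/asboolP; exists y0.
have bQ m : Q m -> (m <= size Y)%N.
  by move=> /asboolP[y [_ _ <-]]; apply: index_size.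
case: (ex_maxnP exQ bQ) => m /asboolP[y [yY Py <-]] mmax.
by exists y; split=> // y' y'Y Py'; apply: mmax; apply/asboolP; exists y'.
Qed.

Lemma ord3_others (k : 'I_3) : exists k1 k2 : 'I_3, [/\ k1 != k, k2 != k & k1 != k2].
Proof.
case: k => -[|[|[|//]]] hk.
- by exists (@Ordinal 3 1 isT), (@Ordinal 3 2 isT).
- by exists (@Ordinal 3 0 isT), (@Ordinal 3 2 isT).
- by exists (@Ordinal 3 0 isT), (@Ordinal 3 1 isT).
Qed.

Section burton_keane.
Variables (G : pred col) (Y : seq col) (I : eqType) (s : seq I).
Variables (B : I -> pred col) (a : I -> 'I_3 -> col).
Hypothesis BG : forall i x, i \in s -> B i x -> G x.
Hypothesis Bconn : forall i x y, i \in s -> B i x -> B i y -> conn (B i) x y.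
Hypothesis Bdisj : forall i j x, i \in s -> j \in s -> i != j -> B i x -> ~~ B j x.
Hypothesis aY : forall i k, i \in s -> a i k \in Y.
Hypothesis BY : forall i y, i \in s -> y \in Y -> ~~ B i y.

Definition off (i : I) : pred col := fun c => G c && ~~ B i c.
Definition attached (i : I) (y : col) :=
  exists b x, [/\ B i b, col_adj b x & conn (off i) x y].

Hypothesis a_attached : forall i k, i \in s -> attached i (a i k).
Hypothesis a_separated : forall i k l, i \in s -> k != l ->
  ~ conn (off i) (a i k) (a i l).

Let idx y := index y Y.

Lemma off_sub i c : off i c -> G c.
Proof. by case/andP. Qed.

Lemma attached_conn i b y : i \in s -> B i b -> attached i y -> conn G b y.
Proof.
move=> si Bb [b' [x [Bb' bx c]]].
apply: (@conn_trans _ b').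
  by apply: conn_sub (Bconn si Bb Bb') => z; apply: BG.
apply: (@conn_trans _ x).
  apply: conn_edge => //; first exact: BG Bb'.
  by have [/off_sub] := conn_in c.
exact: conn_sub (@off_sub i) c.
Qed.

(** The column [y] is the last boundary column of its branch at the box [i], and
    comes first among those of the three branches; the box will be charged to it.
    For every root [r] that is last in the cluster of the box, [y] is not in the
    branch of the root, and neither is a second branch, represented by [z]. *)
Definition low_branch (i : I) (y : col) :=
  [/\ y \in Y, attached i y,
    forall y', y' \in Y -> conn (off i) y y' -> (idx y' <= idx y)%N &
    forall r, r \in Y ->
      (forall y', y' \in Y -> attached i y' -> (idx y' <= idx r)%N) ->
      ~ conn (off i) r y /\
      exists z, [/\ z \in Y, attached i z, ~ conn (off i) r z & (idx y < idx z)%N]].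

Lemma ex_low_branch i : i \in s -> exists y, low_branch i y.
Proof.
move=> si.
have exw k : exists w, [/\ w \in Y, conn (off i) (a i k) w &
    forall y', y' \in Y -> conn (off i) (a i k) y' -> (idx y' <= idx w)%N].
  apply: (ex_last_index (aY k si)); apply: conn_refl.
  by have [b [x [_ _ /conn_in[]]]] := a_attached k si.
have {exw} [w hw] := choice exw.
have wY k : w k \in Y by have [] := hw k.
have cw k : conn (off i) (a i k) (w k) by have [] := hw k.
have wmax k y' : y' \in Y -> conn (off i) (a i k) y' -> (idx y' <= idx (w k))%N.
  by have [_ _] := hw k; apply.
have wsep k l : k != l -> ~ conn (off i) (w k) (w l).
  move=> kl c; apply: (a_separated si kl); apply: conn_trans (cw k) _.
  exact: conn_trans c (conn_sym (cw l)).
have watt k : attached i (w k).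
  have [b [x [Bb bx c]]] := a_attached k si.
  by exists b, x; split=> //; apply: conn_trans c (cw k).
have [k0 _ k0min] : exists2 k0, true & forall k, (idx (w k0) <= idx (w k))%N.
  by case: (@arg_minnP _ ord0 predT (fun k => idx (w k))) => // k _ h; exists k => // l; apply: h.
have strict k : k != k0 -> (idx (w k0) < idx (w k))%N.
  move=> kk0; rewrite ltn_neqAle k0min andbT; apply/eqP => e.
  have ew : w k0 = w k.
    by rewrite -(nth_index (w k) (wY k0)) -/(idx _) e nth_index.
  by apply: (wsep _ _ kk0); rewrite ew; apply: conn_refl; have [] := conn_in (cw k).
exists (w k0); split=> //.
  by move=> y' y'Y c; apply: wmax => //; apply: conn_trans c.
move=> r rY rmax.
have [k1 [k2 [k10 k20 k12]]] := ord3_others k0.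
split.
  move=> c; have h1 := strict _ k10.
  have h2 : (idx r <= idx (w k0))%N.
    by apply: wmax => //; apply: conn_trans (cw k0) (conn_sym c).
  have h3 := rmax _ (wY k1) (watt k1).
  by have := leq_trans (leq_trans h1 h3) h2; rewrite ltnn.
have [c1|nc1] := pselect (conn (off i) r (w k1)).
  exists (w k2); split=> //; last exact: strict.
  by move=> c2; apply: (wsep _ _ k12); apply: conn_trans (conn_sym c1) c2.
by exists (w k1); split=> //; apply: strict.
Qed.

(** A path from the box [j] to a branch away from the root cannot meet the box [i]:
    from there it would reach the root without crossing [j]. *)
Lemma branches_nested i j r bi bj y z :
  i \in s -> j \in s -> i != j -> r \in Y -> B i bi -> B j bj -> conn G r bi ->
  ~ conn (off i) r bj -> attached j y -> attached j z ->
  ~ conn (off j) r y -> ~ conn (off j) r z -> conn (off i) y z.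
Proof.
move=> si sj ij rY Bbi Bbj crbi nci.
have ji : j != i by rewrite eq_sym.
have offj v : B i v -> off j v by move=> Bv; rewrite /off (BG si Bv) (Bdisj si sj ij Bv).
have offi v : B j v -> off i v by move=> Bv; rewrite /off (BG sj Bv) (Bdisj sj si ji Bv).
have crB v : B i v -> conn (off j) r v.
  have : ~~ predC (B i) bi by rewrite /= negbK.
  case/(conn_exit crbi (BY si rY)) => u [w [c uw /negPn Bw _]] Bv.
  have cu : conn (off j) r u.
    apply: (conn_avoid c) => x cx; rewrite /off.
    have /andP[-> /= nBx] := (conn_in cx).2.
    apply/negP => Bx; apply: nci; apply: (@conn_trans _ x).
      by apply: conn_sub cx => t /andP[Gt nBt]; rewrite /off Gt.
    by apply: conn_sub (Bconn sj Bx Bbj).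
  apply: conn_trans (conn_step cu (offj _ Bw) uw) _.
  exact: conn_sub offj (Bconn si Bw Bv).
have toward t : attached j t -> ~ conn (off j) r t -> conn (off i) bj t.
  move=> [b [x [Bb bx c]]] nct.
  apply: (@conn_trans _ b); first exact: conn_sub offi (Bconn sj Bbj Bb).
  have c' : conn (off i) x t.
    apply: (conn_avoid c) => v cv; rewrite /off (off_sub (conn_in cv).2) /=.
    apply/negP => Bv; apply: nct.
    exact: conn_trans (crB v Bv) (conn_trans (conn_sym cv) c).
  apply: conn_trans (c'); apply: conn_edge => //; first exact: offi.
  by have [] := conn_in c'.
move=> ay az ny nz.
exact: conn_trans (conn_sym (toward _ ay ny)) (toward _ az nz).
Qed.

(** Two boxes charged to [y] lie in one cluster; let [r] be its last boundary column.
    If one of the boxes separates the other from [r], the branch of the first that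
    contains [y] also contains a boundary column later than [y]. If none does, the
    branch of [y] at one box contains the other box, hence [r]. *)
Lemma low_branch_inj i j y : i \in s -> j \in s -> low_branch i y ->
  low_branch j y -> i = j.
Proof.
move=> si sj [yY ayi maxi rooti] [_ ayj maxj rootj].
apply/eqP/negPn/negP => ij.
have ji : j != i by rewrite eq_sym.
have [bi [xi [Bbi bxi ci]]] := ayi.
have [bj [xj [Bbj bxj cj]]] := ayj.
have Gy : G y by apply: off_sub (conn_in ci).2.
have [r [rY cyr rmax]] := ex_last_index (P := conn G y) yY (conn_refl Gy).
have catt t i' : i' \in s -> attached i' y -> attached i' t -> conn G y t.
  move=> si' ay' at'; have [b [_ [Bb _ _]]] := ay'.
  exact: conn_trans (conn_sym (attached_conn si' Bb ay')) (attached_conn si' Bb at').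
have cbi : conn G r bi.
  exact: conn_trans (conn_sym cyr) (conn_sym (attached_conn si Bbi ayi)).
have cbj : conn G r bj.
  exact: conn_trans (conn_sym cyr) (conn_sym (attached_conn sj Bbj ayj)).
have [|nyi [zi [ziY azi nzi yzi]]] := rooti r rY.
  by move=> y' y'Y ay'; apply: rmax => //; apply: catt ay'.
have [|nyj [zj [zjY azj nzj yzj]]] := rootj r rY.
  by move=> y' y'Y ay'; apply: rmax => //; apply: catt ay'.
have [c1|n1] := pselect (conn (off i) r bj); last first.
  have := branches_nested si sj ij rY Bbi Bbj cbi n1 ayj azj nyj nzj.
  by move/(maxi _ zjY); rewrite leqNgt yzj.
have [c2|n2] := pselect (conn (off j) r bi); last first.
  have := branches_nested sj si ji rY Bbj Bbi cbj n2 ayi azi nyi nzi.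
  by move/(maxj _ ziY); rewrite leqNgt yzi.
apply: nyj; apply: conn_trans c2 _.
have c' : conn (off j) xi y.
  apply: (conn_avoid ci) => v cv; rewrite /off (off_sub (conn_in cv).2) /=.
  apply/negP => Bv; apply: nyi.
  have offi t : B j t -> off i t.
    by move=> Bt; rewrite /off (BG sj Bt) (Bdisj sj si ji Bt).
  apply: (conn_trans c1); apply: (conn_trans (conn_sub offi (Bconn sj Bbj Bv))).
  exact: conn_trans (conn_sym cv) ci.
apply: conn_trans (c'); apply: conn_edge => //.
- by rewrite /off (BG si Bbi) (Bdisj si sj ij Bbi).
- by have [] := conn_in c'.
Qed.

(** The Burton-Keane bound: different boxes are charged to different boundary
    columns. *)
Lemma trifurcation_count : uniq s -> (size s <= size Y)%N.
Proof.
move=> us.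
have ex i : exists y, i \in s -> low_branch i y.
  have [si|nsi] := boolP (i \in s); last by exists (0, 0).
  by have [y h] := ex_low_branch si; exists y.
have [f hf] := choice ex.
rewrite -(size_map f); apply: uniq_leq_size.
  rewrite map_inj_in_uniq // => i j si sj e.
  apply: (low_branch_inj si sj (hf i si)); rewrite e; exact: hf.
by move=> y /mapP[i si ->]; have [] := hf i si.
Qed.

End burton_keane.

(** * Arms from the half sides of a box *)

Definition turn (c : col) : col := (c.2, - c.1).
Definition mirror (c : col) : col := (- c.1, c.2).
(** The eight symmetries of the square, which carry the upper left half side of a
    box to its eight half sides. *)
Definition side (k : nat) (b : bool) (c : col) : col :=
  iter k turn (if b then mirror c else c).

Lemma turn_adj c d : col_adj c d -> col_adj (turn c) (turn d).
Proof. by move=> /col_adjP h; apply/col_adjP; move: h; case: c d => [? ?] [? ?] /=; lia. Qed.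

Lemma mirror_adj c d : col_adj c d -> col_adj (mirror c) (mirror d).
Proof. by move=> /col_adjP h; apply/col_adjP; move: h; case: c d => [? ?] [? ?] /=; lia. Qed.

Lemma turn_norm c : cnorm (turn c) = cnorm c.
Proof. by rewrite /cnorm /turn /= abszN maxnC. Qed.

Lemma mirror_norm c : cnorm (mirror c) = cnorm c.
Proof. by rewrite /cnorm /mirror /= abszN. Qed.

Lemma mirrorK : involutive mirror.
Proof. by case=> a b; rewrite /mirror /= opprK. Qed.

Lemma turn4 c : turn (turn (turn (turn c))) = c.
Proof. by case: c => a b; rewrite /turn /= !opprK. Qed.

Lemma iter_turn4 k c : iter (4 * k)%N turn c = c.
Proof. by elim: k c => // k IH c; rewrite mulnS iterD IH /= turn4. Qed.

Lemma iter_turnK k : cancel (iter k turn) (iter (3 * k)%N turn).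
Proof. by move=> c; rewrite -iterD -{2}(iter_turn4 k c); congr iter; lia. Qed.

Lemma iter_turnVK k : cancel (iter (3 * k)%N turn) (iter k turn).
Proof. by move=> c; rewrite -iterD -{2}(iter_turn4 k c); congr iter; lia. Qed.

Lemma iter_turn_mod k c : iter (k %% 4) turn c = iter k turn c.
Proof. by rewrite {2}(divn_eq k 4) addnC iterD mulnC iter_turn4. Qed.

Lemma iter_turn_adj k c d : col_adj c d -> col_adj (iter k turn c) (iter k turn d).
Proof. by elim: k => // k IH /IH /turn_adj. Qed.

Lemma iter_turn_norm k c : cnorm (iter k turn c) = cnorm c.
Proof. by elim: k => //= k IH; rewrite turn_norm. Qed.

Lemma side_adj k b c d : col_adj c d -> col_adj (side k b c) (side k b d).
Proof. by move=> cd; apply: iter_turn_adj; case: b => //; apply: mirror_adj. Qed.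

Lemma side_norm k b c : cnorm (side k b c) = cnorm c.
Proof. by rewrite /side iter_turn_norm; case: b => //; rewrite mirror_norm. Qed.

Definition top_left (n : nat) (c : col) : bool :=
  (c.2 == n%:Z + 1) && (- n%:Z <= c.1 <= 0).

Definition arm (n N : nat) (tau : pred col) : Prop :=
  exists x y, [/\ top_left n x, cnorm y = N & conn (predI tau (shell n N)) x y].

Definition adjacent_to_box (n : nat) (x : col) :=
  exists2 b, (cnorm b <= n)%N & col_adj b x.

Definition cross (n N : nat) (tau : pred col) : Prop :=
  exists x y, [/\ adjacent_to_box n x, cnorm y = N & conn (predI tau (shell n N)) x y].

Lemma arm_side n N (tau : pred col) k b : arm n N (tau \o side k b) ->
  exists x y, [/\ top_left n x, cnorm y = N & conn (predI tau (shell n N)) (side k b x) y].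
Proof.
move=> [x [y [tx yN c]]]; exists x, (side k b y); split=> //.
  by rewrite side_norm.
apply: conn_map c; first exact: side_adj.
by move=> z; rewrite /= /shell side_norm.
Qed.

Lemma arm_at n N (tau : pred col) k b x y : top_left n x -> cnorm y = N ->
  conn (predI tau (shell n N)) (side k b x) y -> arm n N (tau \o side k b).
Proof.
move=> tx yN c.
pose g c := (if b then mirror else id) (iter (3 * k)%N turn c).
have gV : cancel (side k b) g.
  by move=> z; rewrite /g /side; case: (b); rewrite /= iter_turnK ?mirrorK.
have Vg : cancel g (side k b).
  by move=> z; rewrite /g /side; case: (b); rewrite /= ?mirrorK iter_turnVK.
have gadj u v : col_adj u v -> col_adj (g u) (g v).
  by rewrite /g => uv; case: (b); [apply: mirror_adj|]; apply: iter_turn_adj.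
have gnorm u : cnorm (g u) = cnorm u.
  by rewrite /g; case: (b); rewrite ?mirror_norm iter_turn_norm.
exists x, (g y); split=> //; first by rewrite gnorm.
rewrite -(gV x); apply: conn_map gadj _ c => z.
by rewrite /= Vg /shell gnorm.
Qed.

(** A path leaving a box avoids the corners of the surrounding ring, and the rest
    of the ring is made of the eight half sides. *)
Lemma cross_arm n N (tau : pred col) : cross n N tau ->
  exists k b, (k < 4)%N /\ arm n N (tau \o side k b).
Proof.
move=> [x [y [[b0 bn bx] yN c]]].
have /andP[_ /= xs] := (conn_in c).1.
pose cand k b c := (k < 4)%N /\ top_left n c /\ side k b c = x.
suff [k [b [c0 [k4 [tc ex]]]]] : exists k b c, cand k b c.
  by exists k, b; split=> //; apply: arm_at tc yN _; rewrite ex.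
move: bx bn xs => /col_adjP; case: x b0 {c} @cand => x1 x2 [b1 b2] cand.
rewrite /cnorm /shell /cnorm /= => bx bn xs.
have sol k b c1 c2 : (k < 4)%N -> c2 = n%:Z + 1 -> - n%:Z <= c1 <= 0 ->
    side k b (c1, c2) = (x1, x2) -> exists k b c, cand k b c.
  by move=> h1 h2 h3 h4; exists k, b, (c1, c2); split=> //; split=> //;
    rewrite /top_left /= h2 eqxx h3.
have {bx} [[h1 h2]|[h1 h2]] : (`|x2| = n.+1)%N /\ (`|x1| <= n)%N \/
    (`|x1| = n.+1)%N /\ (`|x2| <= n)%N.
- by case: bx => -[e [e'|e']]; [left|left|right|right]; clear - e e' bn xs; lia.
- have [p1|p1] := leP 0 x1; have [p2|p2] := leP 0 x2.
  + by apply: (sol 0%N true (- x1) x2); rewrite /side /= /turn /mirror /= ?opprK //;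
      clear - h1 h2 p1 p2; lia.
  + by apply: (sol 2%N false (- x1) (- x2)); rewrite /side /= /turn /mirror /= ?opprK //;
      clear - h1 h2 p1 p2; lia.
  + by apply: (sol 0%N false x1 x2) => //; clear - h1 h2 p1 p2; lia.
  + by apply: (sol 2%N true x1 (- x2)); rewrite /side /= /turn /mirror /= ?opprK //;
      clear - h1 h2 p1 p2; lia.
- have [p1|p1] := leP 0 x1; have [p2|p2] := leP 0 x2.
  + by apply: (sol 1%N false (- x2) x1); rewrite /side /= /turn /mirror /= ?opprK //;
      clear - h1 h2 p1 p2; lia.
  + by apply: (sol 1%N true x2 x1); rewrite /side /= /turn /mirror /= ?opprK //;
      clear - h1 h2 p1 p2; lia.
  + by apply: (sol 3%N true (- x2) (- x1)); rewrite /side /= /turn /mirror /= ?opprK //;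
      clear - h1 h2 p1 p2; lia.
  + by apply: (sol 3%N false x2 (- x1)); rewrite /side /= /turn /mirror /= ?opprK //;
      clear - h1 h2 p1 p2; lia.
Qed.

(** Each of the three plus arms has a minus arm on both sides, in the cyclic order
    around the box. *)
Definition seven_arms (n N : nat) (tau : pred col) : Prop :=
  (forall k, (k < 3)%N -> arm n N (tau \o side k false)) /\
  (forall k, (k < 4)%N -> arm n N (predC tau \o side k true)).

Lemma tl_side_adjacent n k b x : top_left n x -> adjacent_to_box n (side k b x).
Proof.
case: x => x1 x2; rewrite /top_left /= => /andP[/eqP -> h].
exists (side k b (x1, n%:Z)).
  by rewrite side_norm /cnorm /=; clear - h; lia.
by apply: side_adj; apply/col_adjP => /=; clear; lia.
Qed.

(** Turning the picture brings any two of the plus arms to the position of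
    [arms_separate]. *)
Lemma seven_separated n N (tau : pred col) : (0 < n)%N -> seven_arms n N tau ->
  exists x y : 'I_3 -> col,
    (forall k, [/\ adjacent_to_box n (x k), cnorm (y k) = N &
                   conn (predI tau (shell n N)) (x k) (y k)]) /\
    (forall k l, k != l -> ~ conn (predI tau (shell n N)) (x k) (x l)).
Proof.
move=> n0 [plus minus].
have exx (k : 'I_3) : exists xy : col * col, [/\ top_left n xy.1, cnorm xy.2 = N &
    conn (predI tau (shell n N)) (side k false xy.1) xy.2].
  by have [x [y h]] := arm_side (plus k (ltn_ord k)); exists (x, y).
have {exx} [xy hxy] := choice exx.
have minus' k : exists x y, [/\ top_left n x, cnorm y = N &
    conn (predI (predC tau) (shell n N)) (iter k turn (mirror x)) y].
  have [x [y h]] := arm_side (minus (k %% 4)%N (@ltn_pmod k 4 isT)).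
  by exists x, y; move: h; rewrite /side iter_turn_mod.
exists (fun k : 'I_3 => side k false (xy k).1), (fun k => (xy k).2); split.
  by move=> k; have [h1 h2 h3] := hxy k; split=> //; apply: tl_side_adjacent.
suff sep (k l : 'I_3) : (k < l)%N ->
    ~ conn (predI tau (shell n N)) (side k false (xy k).1) (side l false (xy l).1).
  move=> k l; rewrite -val_eqE neq_ltn => /orP[kl|lk]; first exact: sep.
  by move/conn_sym; apply: sep.
move=> kl ckl.
have [tk _ _] := hxy k; have [top_left' _ _] := hxy l.
pose A : pred col := tau \o iter k turn.
have pull (T : pred col) u v : conn (predI T (shell n N)) u v ->
    conn (predI (T \o iter k turn) (shell n N)) (iter (3 * k)%N turn u) (iter (3 * k)%N turn v).
  apply: conn_map; first by move=> ? ?; apply: iter_turn_adj.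
  by move=> z; rewrite /= iter_turnVK /shell iter_turn_norm.
have [zp [u [tzp uN /pull cp]]] := minus' (k + 3)%N.
have [zq [w [tzq wN /pull cq]]] := minus' k.
move: cp cq; rewrite iter_turnK iterD iter_turnK => cp cq.
move/pull: ckl; rewrite /side iter_turnK -(subnKC (ltnW kl)) iterD iter_turnK.
set xk := (xy k).1 in tk *; set xl := (xy l).1 in top_left' *.
move=> ckl.
have lk : (l - k = 1)%N \/ (l - k = 2)%N.
  by have := ltn_ord l; clear - kl; lia.
move: tk top_left' tzp tzq; rewrite /top_left.
move=> /andP[/eqP tk2 tk1] /andP[/eqP tl2 tl1] /andP[/eqP tp2 tp1] /andP[/eqP tq2 tq1].
apply: (arms_separate n0 _ _ _ _ tk2 tk1 _ _ cp cq ckl) => /=.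
- by rewrite tp2; clear; lia.
- by clear - tp1; lia.
- by [].
- by clear - tq1; lia.
- by rewrite iter_turn_norm.
- by rewrite iter_turn_norm.
- case: lk => -> /=; [left|right]; clear - tl1 tl2; lia.
Qed.

Lemma conn_ring (A : pred col) (N : nat) x y : conn A x y ->
  (cnorm x <= N)%N -> (N <= cnorm y)%N ->
  exists2 z, cnorm z = N & conn (fun c => A c && (cnorm c <= N)%N) x z.
Proof.
move=> c xN Ny.
have [Ax Ay] := conn_in c.
have [xe|xl] : cnorm x = N \/ (cnorm x < N)%N by clear - xN; lia.
  by exists x => //; apply: conn_refl; rewrite Ax xe leqnn.
have [|u [v [cu uv nv cv]]] := conn_exit (B := fun z => (cnorm z < N)%N) c xl.
  by rewrite -leqNgt.
have un := (conn_in cu).2; have {un} un : (cnorm u < N)%N by case/andP: un.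
have uv' := cnorm_adj uv.
exists v; first by clear - un uv' nv; lia.
apply: (@conn_step _ _ u) => //.
  by apply: conn_sub cu => z /= /andP[-> /ltnW].
by rewrite (conn_in cv).1; clear - un uv' nv; lia.
Qed.

Definition translate (v : col) (c : col) : col := (c.1 + v.1, c.2 + v.2).
Definition untranslate (v : col) (c : col) : col := (c.1 - v.1, c.2 - v.2).

Definition interval_seq (n : nat) : seq int := [seq k%:Z - n%:Z | k <- iota 0 (n + n).+1].

Lemma mem_interval_seq n (k : int) : (k \in interval_seq n) = (`|k| <= n)%N.
Proof.
apply/mapP/idP => [[j]|h]; first by rewrite mem_iota; lia.
by exists (absz (k + n%:Z)); rewrite ?mem_iota; lia.
Qed.

Lemma interval_seq_uniq n : uniq (interval_seq n).
Proof. by rewrite map_inj_uniq ?iota_uniq // => i j; lia. Qed.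

Definition ring_cols (N : nat) : seq col :=
  [seq (N%:Z, k) | k <- interval_seq N] ++ [seq (- N%:Z, k) | k <- interval_seq N] ++
  [seq (k, N%:Z) | k <- interval_seq N] ++ [seq (k, - N%:Z) | k <- interval_seq N].

Lemma mem_ring_cols N c : (c \in ring_cols N) = (cnorm c == N).
Proof.
have vert (x a b : int) : (((a, b) : col) \in [seq (x, k) | k <- interval_seq N]) =
    (a == x) && (`|b| <= N)%N.
  rewrite -mem_interval_seq; apply/mapP/andP => [[k hk [-> ->]]|[/eqP -> h]].
    by rewrite eqxx.
  by exists b.
have horiz (x a b : int) : (((a, b) : col) \in [seq (k, x) | k <- interval_seq N]) =
    (b == x) && (`|a| <= N)%N.
  rewrite -mem_interval_seq; apply/mapP/andP => [[k hk [-> ->]]|[/eqP -> h]].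
    by rewrite eqxx.
  by exists a.
case: c => a b; rewrite /ring_cols !mem_cat !vert !horiz /cnorm /=; clear; lia.
Qed.

Lemma size_ring_cols N : size (ring_cols N) = (4 * (N + N).+1)%N.
Proof. by rewrite /ring_cols !size_cat !size_map size_iota; clear; lia. Qed.

(** A filled box with seven arms is a Burton-Keane trifurcation: removing it splits
    its plus cluster into three long branches at least. *)
Definition trifurcation (n N : nat) (tau : pred col) : Prop :=
  seven_arms n N tau /\ forall c, (cnorm c <= n)%N -> tau c.

Lemma translate_adj v c d : col_adj c d -> col_adj (translate v c) (translate v d).
Proof. by move=> /col_adjP h; apply/col_adjP; move: h; case: c d v => [? ?] [? ?] [? ?] /=;
  lia. Qed.

Lemma box_conn n x y : (cnorm x <= n)%N -> (cnorm y <= n)%N ->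
  conn (fun c => (cnorm c <= n)%N) x y.
Proof.
have to0 z : (cnorm z <= n)%N -> conn (fun c => (cnorm c <= n)%N) z (0, 0).
  case: z => a b; rewrite /cnorm /= => h.
  apply: (@conn_trans _ (a, 0)).
    have [b0|b0] := leP 0 b.
      by apply: conn_sym; apply: conn_vert => // k hk; rewrite /cnorm /=; lia.
    by apply: conn_vert => [|k hk]; [lia | rewrite /cnorm /=; lia].
  have [a0|a0] := leP 0 a.
    by apply: conn_sym; apply: conn_horiz => // k hk; rewrite /cnorm /=; lia.
  by apply: conn_horiz => [|k hk]; [lia | rewrite /cnorm /=; lia].
by move=> /to0 cx /to0 cy; apply: conn_trans cx (conn_sym cy).
Qed.

(** Arms of length [2 * N] leave the box of radius [N] from any centre in it, so the
    branches can be cut at its boundary. *)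
Lemma trifurcations_bound (n N : nat) (tau : pred col) (s : seq col) :
  (0 < n)%N -> uniq s ->
  (forall v, v \in s -> (cnorm v + n < N)%N) ->
  (forall v w, v \in s -> w \in s -> v != w ->
     (n + n < cnorm (untranslate w v))%N) ->
  (forall v, v \in s -> trifurcation n (2 * N)%N (tau \o translate v)) ->
  (size s <= 4 * (N + N).+1)%N.
Proof.
move=> n0 us inN apart tri; rewrite -size_ring_cols.
pose G : pred col := fun c => tau c && (cnorm c <= N)%N.
pose B (v : col) : pred col := fun c => (cnorm (untranslate v c) <= n)%N.
have exa v : exists a : 'I_3 -> col, v \in s ->
   (forall k, [/\ a k \in ring_cols N & attached G B v (a k)]) /\
   (forall k l, k != l -> ~ conn (off G B v) (a k) (a l)).
  have [vs|nvs] := boolP (v \in s); last by exists (fun=> (0, 0)).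
  have [seven full] := tri v vs.
  have [x [y [xy sep]]] := seven_separated n0 seven.
  have vN := inN v vs.
  have sub c : (off G B v) (translate v c) -> predI (tau \o translate v) (shell n (2 * N)%N) c.
    case: c => c1 c2; case/andP=> /andP[/= -> cN nB] /=.
    move: cN nB vN; case: v {vs seven full xy sep} => v1 v2.
    by rewrite /B /untranslate /shell /cnorm /=; clear; lia.
  have exz k : exists z, [/\ cnorm z = N & conn (off G B v) (translate v (x k)) z].
    have [[b bn bx] yN c] := xy k.
    have c' : conn (fun c => tau c && ~~ B v c) (translate v (x k)) (translate v (y k)).
      apply: conn_map c; first by move=> ? ?; apply: translate_adj.
      move=> [c1 c2] /= /andP[-> /=]; rewrite /B /untranslate /shell /cnorm /=; clear; lia.
    have xn := cnorm_adj bx.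
    have [||z zN cz] := conn_ring (N := N) c'.
    - move: xn vN bn; rewrite /cnorm /=; clear; lia.
    - move: yN vN; rewrite /cnorm /=; clear; lia.
    exists z; split=> //; apply: conn_sub cz => d; rewrite /off /G.
    by move=> /andP[/andP[-> ->] ->].
  have [z hz] := choice exz.
  exists z => _; split=> [k|k l kl c].
    have [zN cz] := hz k; split; first by rewrite mem_ring_cols zN.
    have [[b bn bx] _ _] := xy k.
    exists (translate v b), (translate v (x k)); split=> //; last exact: translate_adj.
    by rewrite /B /untranslate /= !addrK; case: (b) bn.
  have [_ ck] := hz k; have [_ cl] := hz l.
  have {}c := conn_trans ck (conn_trans c (conn_sym cl)).
  apply: (sep k l kl).
  pose g := untranslate v.
  have gK d : g (translate v d) = d by case: d => ? ?; rewrite /g /untranslate /= !addrK.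
  have Kg d : translate v (g d) = d by case: d => ? ?; rewrite /g /untranslate /translate /= !subrK.
  rewrite -(gK (x k)) -(gK (x l)); apply: conn_map c; last first.
    by move=> d hd; apply: sub; rewrite Kg.
  move=> c d /col_adjP h; apply/col_adjP; move: h; rewrite /g /untranslate /=.
  case: c d (v) => [? ?] [? ?] [? ?] /=; clear; lia.
have [a ha] := choice exa.
apply: (@trifurcation_count G (ring_cols N) _ s B a) => //.
- move=> v c vs; rewrite /B /G => cB.
  have [_ full] := tri v vs; have vN := inN v vs.
  have := full _ cB; rewrite /= /translate /untranslate /= !subrK => tc.
  have -> : c = (c.1, c.2) by case: (c).
  rewrite tc /=; move: cB vN; rewrite /untranslate /cnorm /=; clear; lia.
- move=> v x y vs Bx By; have := box_conn Bx By.
  move/(conn_map (B := B v) (@translate_adj v)); rewrite /translate /untranslate /= !subrK.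
  case: x y {Bx By} => [? ?] [? ?]; apply.
  by move=> [? ?]; rewrite /B /untranslate /= !addrK.
- move=> v w c vs ws vw; have := apart v w vs ws vw; rewrite /B.
  by case: v w c {vs ws vw} => [? ?] [? ?] [? ?]; rewrite /untranslate /cnorm /=; clear; lia.
- by move=> v k vs; have [/(_ k)[]] := ha v vs.
- move=> v c vs; rewrite mem_ring_cols => /eqP; have := inN v vs; rewrite /B.
  by case: v c {vs} => [? ?] [? ?]; rewrite /untranslate /cnorm /=; clear; lia.
- by move=> v k vs; have [/(_ k)[]] := ha v vs.
- by move=> v k l vs; have [_] := ha v vs; apply.
Qed.

(** * States of the field of column signs *)

(** Locality of functions of the column field is measured by boxes, where the events
    on arms and crossings live. *)
Definition flocal (V : Type) (f : pred col -> V) : Prop :=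
  exists n, forall t t' : pred col,
    (forall c, (cnorm c <= n)%N -> t c = t' c) -> f t = f t'.

Definition increasing_event (A : pred col -> Prop) : Prop :=
  forall t t' : pred col, (forall c, t c -> t' c) -> A t -> A t'.

Definition box_free (n : nat) (A : pred col -> Prop) : Prop :=
  forall t t' : pred col,
    (forall c, (n < cnorm c)%N -> t c = t' c) -> A t -> A t'.

Definition full_box (n : nat) (t : pred col) : Prop :=
  forall c, (cnorm c <= n)%N -> t c.

Section planar_state.
Variable R : realType.

Definition prob (Q : (pred col -> R) -> R) (A : pred col -> Prop) : R :=
  Q (fun t => (`[< A t >])%:R).

(** The properties of the column field on which the absence of percolation rests.
    Flip invariance and mixing are asked of increasing events, which monotonicity in
    the boundary condition controls. *)
Record planar_state (Q : (pred col -> R) -> R) : Prop := PlanarState {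
  ps_cst : forall c, Q (fun=> c) = c;
  ps_add : forall f g, flocal f -> flocal g -> Q (fun t => f t + g t) = Q f + Q g;
  ps_le : forall f g, flocal f -> flocal g -> (forall t, f t <= g t) -> Q f <= Q g;
  ps_fkg : forall A B, flocal A -> flocal B ->
    increasing_event A -> increasing_event B ->
    prob Q A * prob Q B <= prob Q (fun t => A t /\ B t);
  ps_translate : forall A v, flocal A -> prob Q (fun t => A (t \o translate v)) = prob Q A;
  ps_turn : forall A, flocal A -> prob Q (fun t => A (t \o turn)) = prob Q A;
  ps_mirror : forall A, flocal A -> prob Q (fun t => A (t \o mirror)) = prob Q A;
  ps_flip : forall A, flocal A -> increasing_event A ->
    prob Q (fun t => A (predC t)) = prob Q A;
  ps_mixing : forall A e, flocal A -> increasing_event A -> 0 < e ->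
    exists k, forall D, flocal D -> box_free k D ->
      prob Q D * (prob Q A - e) <= prob Q (fun t => D t /\ A t);
  ps_energy : forall n, exists2 c, 0 < c & forall D, flocal D -> box_free n D ->
      c * prob Q D <= prob Q (fun t => D t /\ full_box n t)
}.

Section theory.
Variables (Q : (pred col -> R) -> R) (HQ : planar_state Q).
Local Notation Pr := (prob Q).

Lemma flocal_comp2 (U V W : Type) (h : U -> V -> W) f g :
  flocal f -> flocal g -> flocal (fun t => h (f t) (g t)).
Proof.
move=> [n hn] [m hm]; exists (maxn n m) => t t' tt'.
by rewrite (hn t t') ?(hm t t') // => c hc; apply: tt'; rewrite leq_max hc ?orbT.
Qed.

Lemma flocal_comp (U V : Type) (h : U -> V) f : flocal f -> flocal (h \o f).
Proof. by move=> [n hn]; exists n => t t' tt' /=; rewrite (hn t t'). Qed.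

Lemma flocal_cst (V : Type) (v : V) : flocal (fun=> v).
Proof. by exists 0%N. Qed.

Lemma flocal_pullback (V : Type) (f : pred col -> V) g m :
  (forall c, (cnorm (g c) <= cnorm c + m)%N) -> flocal f ->
  flocal (fun t => f (t \o g)).
Proof.
move=> gm [n hn]; exists (n + m)%N => t t' tt'; apply: hn => c hc /=.
by apply: tt'; apply: leq_trans (gm c) _; rewrite leq_add2r.
Qed.

Lemma flocal_ind A : flocal A -> flocal (fun t => (`[< A t >])%:R : R).
Proof. exact: (flocal_comp (fun P : Prop => (`[< P >])%:R : R)). Qed.

Lemma flocal_not A : flocal A -> flocal (fun t => ~ A t).
Proof. exact: (flocal_comp not). Qed.

Lemma flocal_event (A : pred col -> Prop) n :
  (forall t t' : pred col, (forall c, (cnorm c <= n)%N -> t c = t' c) -> A t -> A t') ->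
  flocal A.
Proof.
move=> h; exists n => t t' tt'; apply/propext; split; apply: h => // c hc.
by rewrite tt'.
Qed.

Lemma prob_sub A B : flocal A -> flocal B -> (forall t, A t -> B t) -> Pr A <= Pr B.
Proof.
move=> lA lB AB; apply: (ps_le HQ); [exact: flocal_ind..|].
move=> t; rewrite ler_nat; case: asboolP => //= At; case: asboolP => // nB.
by case: nB; apply: AB.
Qed.

Lemma prob_ge0 A : flocal A -> 0 <= Pr A.
Proof.
move=> lA; rewrite -(ps_cst HQ 0); apply: (ps_le HQ).
- exact: flocal_cst.
- exact: flocal_ind.
- by move=> t; rewrite ler0n.
Qed.

Lemma prob_split A B : flocal A -> flocal B ->
  Pr A = Pr (fun t => A t /\ B t) + Pr (fun t => A t /\ ~ B t).
Proof.
move=> lA lB; rewrite /prob -(ps_add HQ).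
- congr Q; apply/funext => t; case: asboolP => At; case: asboolP => h1;
    case: asboolP => h2; rewrite ?addr0 ?add0r //.
  + by case: h1 h2 => _ h [_].
  + by case: h1; split=> //; apply: contrapT => nB; apply: h2; split.
  + by case: h1.
  + by case: h1.
  + by case: h2.
- exact/flocal_ind/flocal_comp2.
- exact/flocal_ind/flocal_comp2/flocal_not.
Qed.

Lemma prob_ext A B : (forall t, A t <-> B t) -> Pr A = Pr B.
Proof. by move=> AB; congr prob; apply/funext => t; apply/propext. Qed.

Lemma probT : Pr (fun=> True) = 1.
Proof. by rewrite -[RHS](ps_cst HQ); congr Q; apply/funext => t; case: asboolP. Qed.

Lemma probC A : flocal A -> Pr (fun t => ~ A t) = 1 - Pr A.
Proof.
move=> lA; have := prob_split (flocal_cst True) lA; rewrite probT.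
have -> : Pr (fun t => True /\ A t) = Pr A by apply: prob_ext => t; tauto.
have -> : Pr (fun t => True /\ ~ A t) = Pr (fun t => ~ A t).
  by apply: prob_ext => t; tauto.
by move=> ->; rewrite addrC addKr.
Qed.

Lemma prob_le1 A : flocal A -> Pr A <= 1.
Proof. by move=> lA; rewrite -probT; apply: prob_sub => //; apply: flocal_cst. Qed.

Definition all_of (L : seq (pred col -> Prop)) (t : pred col) : Prop :=
  forall i, (i < size L)%N -> nth (fun=> True) L i t.

Definition some_of (L : seq (pred col -> Prop)) (t : pred col) : Prop :=
  exists2 i, (i < size L)%N & nth (fun=> True) L i t.

Lemma all_of_cons A L : all_of (A :: L) = (fun t => all_of L t /\ A t).
Proof.
apply/funext => t; apply/propext; split=> [h|[h At] [|i] hi //]; last exact: h.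
by split=> [i hi|]; [exact: (h i.+1) | exact: (h 0%N)].
Qed.

Lemma some_of_cons A L : some_of (A :: L) = (fun t => A t \/ some_of L t).
Proof.
apply/funext => t; apply/propext; split.
  by move=> [[|i] hi' h]; [left | right; exists i].
by move=> [h|[i hi' h]]; [exists 0%N | exists i.+1].
Qed.

Lemma all_of_nil : all_of [::] = (fun=> True).
Proof. by apply/funext => t; apply/propext. Qed.

Lemma some_of_nil : some_of [::] = (fun=> False).
Proof. by apply/funext => t; apply/propext; split=> // -[]. Qed.

Lemma prob_all_ge (L : seq (pred col -> Prop)) (q : R) :
  (forall i, (i < size L)%N -> flocal (nth (fun=> True) L i)) ->
  (forall i, (i < size L)%N -> Pr (fun t => ~ nth (fun=> True) L i t) <= q) ->
  flocal (all_of L) /\ 1 - q *+ size L <= Pr (all_of L).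
Proof.
elim: L => [|A L IH] hl hq.
  by rewrite all_of_nil mulr0n subr0 probT; split=> //; apply: flocal_cst.
have [l1 h1] := IH (fun i => hl i.+1) (fun i => hq i.+1).
have lA : flocal A := hl 0%N isT.
have qA := hq 0%N isT; rewrite /= in qA.
rewrite all_of_cons; split; first exact: flocal_comp2.
have := prob_split l1 lA.
have : Pr (fun t => all_of L t /\ ~ A t) <= q.
  apply: le_trans qA; apply: prob_sub; [|exact: flocal_not|by move=> t []].
  exact/flocal_comp2/flocal_not.
by rewrite /= mulrS; lra.
Qed.

(** The square root trick: the failures of increasing events are positively
    associated. *)
Lemma prob_none_ge (L : seq (pred col -> Prop)) (q : R) : 0 <= q ->
  (forall i, (i < size L)%N -> flocal (nth (fun=> True) L i)) ->
  (forall i, (i < size L)%N -> increasing_event (nth (fun=> True) L i)) ->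
  (forall i, (i < size L)%N -> q <= Pr (fun t => ~ nth (fun=> True) L i t)) ->
  flocal (some_of L) /\ q ^+ size L <= Pr (fun t => ~ some_of L t).
Proof.
move=> q0; elim: L => [|A L IH] hl hi hq.
  rewrite some_of_nil expr0; split; first exact: flocal_cst.
  by rewrite -probT; apply: prob_sub => [||t _ //]; apply: flocal_cst.
have [l1 h1] := IH (fun i => hl i.+1) (fun i => hi i.+1) (fun i => hq i.+1).
have lA : flocal A := hl 0%N isT.
have iA : increasing_event A := hi 0%N isT.
have qA := hq 0%N isT; rewrite /= in qA.
have iE : increasing_event (some_of L).
  by move=> t t' tt' [i il h]; exists i => //; apply: (hi i.+1 il) tt' h.
rewrite some_of_cons; split; first exact: flocal_comp2.
set E := some_of L in h1 l1 iE *.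
have s1 := prob_split (flocal_not lA) l1.
have s2 := prob_split l1 lA.
have f1 := ps_fkg HQ lA l1 iA iE.
have cA := probC lA; have cE := probC l1.
have e1 : Pr (fun t => E t /\ ~ A t) = Pr (fun t => ~ A t /\ E t).
  by apply: prob_ext => t; tauto.
have e2 : Pr (fun t => E t /\ A t) = Pr (fun t => A t /\ E t).
  by apply: prob_ext => t; tauto.
have e3 : Pr (fun t => ~ (A t \/ E t)) = Pr (fun t => ~ A t /\ ~ E t).
  by apply: prob_ext => t; tauto.
rewrite e3 /= exprS.
have qq : q * q ^+ size L <= Pr (fun t => ~ A t) * Pr (fun t => ~ E t).
  by apply: ler_pM => //; apply: exprn_ge0.
apply: (le_trans qq); move: f1 s1 s2; rewrite e1 e2 cA cE => f1 s1 s2.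
by clear - f1 s1 s2; lra.
Qed.

End theory.
End planar_state.

(** * Absence of percolation in a flip-invariant state *)

Lemma shell_agree n N (t t' : pred col) x y :
  (forall c, shell n N c -> t c -> t' c) ->
  conn (predI t (shell n N)) x y -> conn (predI t' (shell n N)) x y.
Proof. by move=> h; apply: conn_sub => z /= /andP[tz sz]; rewrite sz h. Qed.

Lemma arm_agree n N (t t' : pred col) :
  (forall c, shell n N c -> t c -> t' c) -> arm n N t -> arm n N t'.
Proof. by move=> h [x [y [tx yN c]]]; exists x, y; split=> //; apply: shell_agree c. Qed.

Lemma cross_agree n N (t t' : pred col) :
  (forall c, shell n N c -> t c -> t' c) -> cross n N t -> cross n N t'.
Proof. by move=> h [x [y [tx yN c]]]; exists x, y; split=> //; apply: shell_agree c. Qed.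

Lemma shell_side n N k b c : shell n N (side k b c) = shell n N c.
Proof. by rewrite /shell side_norm. Qed.

Lemma seven_agree n N (t t' : pred col) :
  (forall c, shell n N c -> t c = t' c) -> seven_arms n N t -> seven_arms n N t'.
Proof.
move=> h [p m]; split=> k hk.
  by apply: arm_agree (p k hk) => c sc /=; rewrite h // shell_side.
by apply: arm_agree (m k hk) => c sc /=; rewrite h // shell_side.
Qed.

Lemma shell_le n N c : shell n N c -> (cnorm c <= N)%N.
Proof. by case/andP. Qed.

Lemma shell_gt n N c : shell n N c -> (n < cnorm c)%N.
Proof. by case/andP. Qed.

Lemma flocal_arm n N : flocal (arm n N).
Proof.
apply: (@flocal_event _ N) => t t' tt'; apply: arm_agree => c /shell_le h.
by rewrite tt'.
Qed.

Lemma flocal_cross n N : flocal (cross n N).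
Proof.
apply: (@flocal_event _ N) => t t' tt'; apply: cross_agree => c /shell_le h.
by rewrite tt'.
Qed.

Lemma flocal_seven n N : flocal (seven_arms n N).
Proof.
apply: (@flocal_event _ N) => t t' tt'; apply: seven_agree => c /shell_le h.
by rewrite tt'.
Qed.

Lemma flocal_full n : flocal (full_box n).
Proof. by apply: (@flocal_event _ n) => t t' tt' h c hc; rewrite -tt' ?h. Qed.

Lemma conn_last_exit (A : pred col) n x y : conn A x y ->
  (cnorm x <= n)%N -> (n < cnorm y)%N ->
  exists2 u, adjacent_to_box n u & conn (fun c => A c && (n < cnorm c)%N) u y.
Proof.
move=> /conn_sym c xn yn.
have [|u [v [cu uv nv _]]] := conn_exit (B := fun c => (n < cnorm c)%N) c yn.
  by rewrite -leqNgt.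
exists u; last exact: conn_sym.
by exists v; [rewrite leqNgt | apply: col_adj_sym].
Qed.

Lemma cross_inner n k N t : (n <= k)%N -> (k < N)%N -> cross n N t -> cross k N t.
Proof.
rewrite leq_eqVlt => /orP[/eqP -> //|nk] kN [x [y [[b bn bx] yN c]]].
have xk : (cnorm x <= k)%N by apply: leq_trans (cnorm_adj bx) _; apply: leq_ltn_trans nk.
have [|u au cu] := conn_last_exit c xk; first by rewrite yN.
exists u, y; split=> //; apply: conn_sub cu => z.
by rewrite /= /shell => /andP[/andP[-> /andP[_ ->]] ->].
Qed.

Lemma cross_outer n N N' t : (n < N)%N -> (N <= N')%N -> cross n N' t -> cross n N t.
Proof.
move=> nN NN' [x [y [[b bn bx] yN c]]].
have xN : (cnorm x <= N)%N by apply: leq_trans (cnorm_adj bx) _; apply: leq_ltn_trans nN.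
have [|z zN cz] := conn_ring c xN; first by rewrite yN.
exists x, z; split=> //; first by exists b.
by apply: conn_sub cz => d; rewrite /= /shell => /andP[/andP[-> /andP[-> _]] ->].
Qed.

Definition reaches (N : nat) (t : pred col) : Prop :=
  exists2 y, cnorm y = N & conn (fun c => t c && (cnorm c <= N)%N) (0, 0) y.

Lemma reaches_cross n N t : (n < N)%N -> reaches N t -> cross n N t.
Proof.
move=> nN [y yN c].
have [||u au cu] := conn_last_exit (n := n) c; [by []|by rewrite yN|].
exists u, y; split=> //; apply: conn_sub cu => z.
by rewrite /= /shell => /andP[/andP[-> ->] ->].
Qed.

Lemma flocal_reaches N : flocal (reaches N).
Proof.
apply: (@flocal_event _ N) => t t' tt' [y yN c]; exists y => //.
by apply: conn_sub c => z /andP[tz zN]; rewrite -tt' ?tz.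
Qed.

Section no_percolation.
Variables (R : realType) (Q : (pred col -> R) -> R) (HQ : planar_state Q).
Local Notation Pr := (prob Q).

Lemma increasing_cross n N : increasing_event (cross n N).
Proof. by move=> t t' tt'; apply: cross_agree => c _; apply: tt'. Qed.

Lemma increasing_arm_side n N k b : increasing_event (fun t => arm n N (t \o side k b)).
Proof. by move=> t t' tt'; apply: arm_agree => c _; apply: tt'. Qed.

Lemma flocal_arm_side n N k b : flocal (fun t => arm n N (t \o side k b)).
Proof.
apply: (flocal_pullback (m := 0)) (flocal_arm n N) => c.
by rewrite side_norm addn0.
Qed.

Lemma prob_turn A k : flocal A -> Pr (fun t => A (t \o iter k turn)) = Pr A.
Proof.
move=> lA; elim: k => [|k IH]; first by [].
rewrite -IH -[RHS](ps_turn HQ) //.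
by apply: (flocal_pullback (m := 0)) lA => c; rewrite iter_turn_norm addn0.
Qed.

Lemma prob_side A k b : flocal A -> Pr (fun t => A (t \o side k b)) = Pr A.
Proof.
move=> lA; case: b.
  rewrite -[RHS](ps_mirror HQ) // -[RHS](prob_turn k) //.
  by apply: (flocal_pullback (m := 0)) lA => c; rewrite mirror_norm addn0.
by rewrite -[RHS](prob_turn k).
Qed.

(** Given that no crossing from [k] to far away exists, mixing still leaves a
    probability at least [theta / 2] to a crossing of a fixed annulus close to the
    origin. That annulus being crossed while longer ones are not is unlikely, since
    the crossing probabilities converge. So long crossings from [k] rarely fail. *)
Lemma zero_one theta eta : 0 < theta -> 0 < eta ->
  (forall N, theta <= Pr (reaches N)) ->
  exists2 n, (0 < n)%N & forall N, (n < N)%N -> Pr (fun t => ~ cross n N t) <= eta.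
Proof.
move=> th0 eta0 hth.
pose u N := Pr (fun t => ~ cross 0 N.+1 t).
have crossP n N : (n < N)%N -> theta <= Pr (cross n N).
  move=> nN; apply: le_trans (hth N) _; apply: prob_sub => //.
  - exact: flocal_reaches.
  - exact: flocal_cross.
  - by move=> t; apply: reaches_cross.
have lnc n N : flocal (fun t => ~ cross n N t) by apply/flocal_not/flocal_cross.
have u_le N N' : (N <= N')%N -> u N <= u N'.
  by move=> NN'; apply: prob_sub => // t nc c; apply: nc; apply: cross_outer c.
pose eta' := eta * theta / 2.
have eta'0 : 0 < eta' by rewrite /eta' divr_gt0 // mulr_gt0.
have [N1 hN1] : exists N1, forall N', (N1 <= N')%N -> u N' <= u N1 + eta'.
  have hs : has_sup (range u).
    split; first by exists (u 0%N); exists 0%N.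
    by exists 1 => _ [N _ <-]; apply: prob_le1.
  have [_ [N1 _ <-] h1] := sup_adherent eta'0 hs.
  exists N1 => N' _; have : u N' <= sup (range u).
    by apply: ub_le_sup; [case: hs | exists N'].
  by move: h1; clear; lra.
have [k hk] := ps_mixing HQ (flocal_cross 0 N1.+1) (@increasing_cross 0 N1.+1)
  (divr_gt0 th0 (ltr0n _ 2)).
exists k.+1 => // N kN.
pose N' := maxn N N1.+1.
have NN' : (N <= N')%N by apply: leq_maxl.
have N1N' : (N1 < N')%N by apply: leq_maxr.
have kN' : (k < N')%N by apply: leq_trans (ltnW kN) NN'.
apply: (@le_trans _ _ (Pr (fun t => ~ cross k N' t))).
  apply: prob_sub => // t nc c; apply: nc; apply: cross_outer (NN') _ => //.
  by apply: cross_inner c => //; apply: leq_trans NN'.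
set D := fun t => ~ cross k N' t.
have freeD : box_free k D.
  move=> t t' tt' nc c; apply: nc; apply: cross_agree c => d /shell_gt kd.
  by rewrite tt'.
have := hk D (lnc _ _) freeD.
have sub : Pr (fun t => D t /\ cross 0 N1.+1 t) <= u N'.-1 - u N1.
  have := prob_split HQ (lnc 0%N N') (flocal_cross 0 N1.+1).
  have -> : Pr (fun t => ~ cross 0 N' t /\ ~ cross 0 N1.+1 t) = u N1.
    apply: prob_ext => t; split=> [[]//|nc]; split=> // c; apply: nc.
    exact: cross_outer c.
  have e : u N'.-1 = Pr (fun t => ~ cross 0 N' t) by rewrite /u prednK // (leq_trans _ N1N').
  rewrite -e => es.
  have : Pr (fun t => D t /\ cross 0 N1.+1 t) <= Pr (fun t => ~ cross 0 N' t /\ cross 0 N1.+1 t).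
    apply: prob_sub => //.
    - exact/flocal_comp2/flocal_cross/lnc.
    - exact/flocal_comp2/flocal_cross/lnc.
    - move=> t [nc h]; split=> // c; apply: nc; exact: cross_inner c.
  by move: es; clear; lra.
have h1 : u N'.-1 <= u N1 + eta' by apply: hN1; rewrite -ltnS prednK // (leq_trans _ N1N').
have h2 := crossP 0%N N1.+1 isT.
have h3 : 0 <= Pr D by apply: prob_ge0 => //; exact: lnc.
move=> h4.
have h5 : Pr D * (theta / 2) <= eta'.
  apply: le_trans (_ : Pr D * (Pr (cross 0 N1.+1) - theta / 2) <= _).
    by apply: ler_wpM2l => //; move: h2; clear; lra.
  by move: h1 h4 sub; clear; lra.
have e : eta' = eta * (theta / 2) by rewrite /eta' mulrA.
by move: h5; rewrite e ler_pM2r // divr_gt0.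
Qed.

(** The eight half sides are equally likely to fail. If crossings fail with probability
    at most the eighth power of 1/14, then each half side fails with probability at
    most 1/14, and some of seven arms with probability at most 1/2. *)
Lemma seven_arms_likely n N (eta : R) : eta = 14^-1 ^+ 8 ->
  Pr (fun t => ~ cross n N t) <= eta -> 2^-1 <= Pr (seven_arms n N).
Proof.
move=> -> hc.
pose A k b := fun t : pred col => arm n N (t \o side k b).
pose q := Pr (fun t => ~ arm n N t).
have q0 : 0 <= q by apply: prob_ge0 => //; apply/flocal_not/flocal_arm.
have qA k b : Pr (fun t => ~ A k b t) = q.
  exact: (prob_side k b (flocal_not (flocal_arm n N))).
have lA k b : flocal (A k b) by apply: flocal_arm_side.
have iA k b : increasing_event (A k b) by apply: increasing_arm_side.
have q14 : q <= 14^-1.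
  pose L := [:: A 0 false; A 0 true; A 1%N false; A 1%N true; A 2%N false; A 2%N true;
    A 3%N false; A 3%N true].
  have [||||lL hL] := @prob_none_ge R Q HQ L q.
  - by [].
  - by do 8?[case; first by move=> _; apply: lA].
  - by do 8?[case; first by move=> _; apply: iA].
  - by do 8?[case; first by rewrite /= qA].
  have := le_trans hL (le_trans _ hc); rewrite ler_pXn2r ?nnegrE //.
  apply; apply: prob_sub => //; [exact: flocal_not | exact/flocal_not/flocal_cross |].
  move=> t ns /cross_arm [k [b [k4 ak]]]; apply: ns.
  exists (2 * k + b)%N; first by case: k k4 {ak} => [|[|[|[|]]]] //; case: (b).
  by case: k k4 ak => [|[|[|[|]]]] // _; case: b.
pose Bm k := fun t : pred col => arm n N (predC t \o side k true).
have lB k : flocal (Bm k).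
  apply: (@flocal_event _ N) => t t' tt'; apply: arm_agree => c /shell_le hc' /=.
  by rewrite tt' // side_norm.
have qB k : Pr (fun t => ~ Bm k t) = q.
  rewrite probC // -(qA k true) probC //; congr (_ - _).
  by rewrite -(ps_flip HQ (lA k true) (iA k true)).
pose L := [:: A 0 false; A 1%N false; A 2%N false; Bm 0; Bm 1%N; Bm 2%N; Bm 3%N].
have [||lL hL] := @prob_all_ge R Q HQ L q.
- by do 7?[case; first by move=> _; first [apply: lA | apply: lB]].
- by do 7?[case; first by rewrite /= ?qA ?qB].
apply: (@le_trans _ _ (Pr (all_of L))).
  by apply: le_trans hL; rewrite /=; move: q14; clear; lra.
apply: prob_sub => //; first exact: flocal_seven.
move=> t h; split.
- by case=> [|[|[|]]] // _; [exact: (h 0%N)|exact: (h 1%N)|exact: (h 2%N)].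
- by case=> [|[|[|[|]]]] // _; [exact: (h 3%N)|exact: (h 4%N)|exact: (h 5%N)|exact: (h 6%N)].
Qed.

Lemma flocal_trifurcation n N : flocal (trifurcation n N).
Proof. exact: flocal_comp2 (flocal_seven n N) (flocal_full n). Qed.

Lemma trifurcation_likely theta : 0 < theta ->
  (forall N, theta <= Pr (reaches N)) ->
  exists n delta, [/\ (0 < n)%N, 0 < delta &
    forall N, (n < N)%N -> delta <= Pr (trifurcation n N)].
Proof.
move=> th0 hth.
have eta0 : 0 < 14^-1 ^+ 8 :> R by apply: exprn_gt0; rewrite invr_gt0.
have [n n0 hn] := zero_one th0 eta0 hth.
have [c c0 hc] := ps_energy HQ n.
exists n, (c / 2); split=> //; first by rewrite divr_gt0.
move=> N nN; have h1 := seven_arms_likely erefl (hn N nN).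
have free : box_free n (seven_arms n N).
  by move=> t t' tt'; apply: seven_agree => d /shell_gt; apply: tt'.
apply: le_trans (hc _ (flocal_seven n N) free).
by rewrite ler_pM2l.
Qed.

Definition grid (n K : nat) : seq col :=
  [seq (((n + n).+1 * i)%:Z, ((n + n).+1 * j)%:Z) | i <- iota 0 K, j <- iota 0 K].

Lemma flocal_sum (I : Type) (s : seq I) (f : I -> pred col -> R) :
  (forall i, flocal (f i)) -> flocal (fun t => \sum_(i <- s) f i t).
Proof.
move=> lf; elim: s => [|i s IH].
  by exists 0%N => t t' _; rewrite !big_nil.
have -> : (fun t => \sum_(j <- i :: s) f j t) = (fun t => f i t + \sum_(j <- s) f j t).
  by apply/funext => t; rewrite big_cons.
exact: flocal_comp2.
Qed.

Lemma state_sum (I : Type) (s : seq I) (f : I -> pred col -> R) :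
  (forall i, flocal (f i)) -> Q (fun t => \sum_(i <- s) f i t) = \sum_(i <- s) Q (f i).
Proof.
move=> lf; elim: s => [|i s IH].
  rewrite big_nil -[RHS](ps_cst HQ); congr Q; apply/funext => t; exact: big_nil.
rewrite big_cons -IH -(ps_add HQ) //; last exact: flocal_sum.
by congr Q; apply/funext => t; rewrite big_cons.
Qed.

(** A box of radius of order [K] holds more than [K ^ 2] disjoint boxes, each of them a
    trifurcation with probability at least [delta], but its boundary has only order
    [K] columns. *)
Lemma no_percolation theta : 0 < theta -> ~ (forall N, theta <= Pr (reaches N)).
Proof.
move=> th0 /(trifurcation_likely th0) [n [delta [n0 d0 hd]]].
have [K hK] : exists K, (8 * (n + n).+1 + 4)%:R / delta < K.+1%:R :> R.
  exists (Num.truncn ((8 * (n + n).+1 + 4)%:R / delta : R)).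
  by apply: truncnS_gt.
pose N := ((n + n).+1 * K.+1)%N.
pose s := grid n K.+1.
have ms v : v \in s -> exists i j, [/\ (i <= K)%N, (j <= K)%N &
    v = (((n + n).+1 * i)%:Z, ((n + n).+1 * j)%:Z)].
  move=> /allpairsP[[i j] [hi hj ->]]; exists i, j.
  by move: hi hj; rewrite !mem_iota /= !add0n !ltnS.
have us : uniq s.
  apply: allpairs_uniq; rewrite ?iota_uniq // => -[i j] [i' j'] _ _ /= [] h1 h2.
  have -> : i = i' by move: h1; clear; nia.
  by have -> : j = j' by move: h2; clear; nia.
have bound t : \sum_(v <- s) (`[< trifurcation n (2 * N) (t \o translate v) >])%:R
    <= (4 * (N + N).+1)%:R :> R.
  rewrite -natr_sum ler_nat.
  set b := fun v => `[< trifurcation n (2 * N)%N (t \o translate v) >].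
  have -> : (\sum_(v <- s) b v = size [seq v <- s | b v])%N.
    by rewrite size_filter -sum1_count [RHS]big_mkcond; apply: eq_bigr => v _; case: (b v).
  apply: (@trifurcations_bound n N t) => //.
  - exact: filter_uniq.
  - move=> v; rewrite mem_filter => /andP[_ /ms[i [j [iK jK ->]]]].
    have hi : ((n + n).+1 * i <= (n + n).+1 * K)%N by rewrite leq_mul2l iK orbT.
    have hj : ((n + n).+1 * j <= (n + n).+1 * K)%N by rewrite leq_mul2l jK orbT.
    by rewrite /cnorm /N mulnS /=; clear - hi hj; lia.
  - move=> v w; rewrite !mem_filter => /andP[_ /ms[i [j [iK jK ->]]]].
    move=> /andP[_ /ms[i' [j' [iK' jK' ->]]]] ne.
    have {ne} ne : (i != i') || (j != j').
      by apply: contraNT ne; rewrite negb_or !negbK => /andP[/eqP-> /eqP->].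
    rewrite /untranslate /cnorm /=; clear - ne; nia.
  - by move=> v; rewrite mem_filter => /andP[/asboolP].
have bl v : flocal (fun t => trifurcation n (2 * N)%N (t \o translate v)).
  apply: (flocal_pullback (m := cnorm v)) (flocal_trifurcation _ _) => c.
  by rewrite /translate /cnorm /=; clear; lia.
have h1 : \sum_(v <- s) Pr (fun t => trifurcation n (2 * N)%N (t \o translate v))
    <= (4 * (N + N).+1)%:R.
  rewrite /prob -state_sum; last by move=> v; apply: flocal_ind.
  rewrite -[leRHS](ps_cst HQ); apply: (ps_le HQ) => //.
  - by apply: flocal_sum => v; apply: flocal_ind.
  - exact: flocal_cst.
have h2 : (K.+1 * K.+1)%:R * delta <=
    \sum_(v <- s) Pr (fun t => trifurcation n (2 * N)%N (t \o translate v)).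
  have -> : (K.+1 * K.+1)%:R * delta = \sum_(v <- s) delta.
    by rewrite big_const_seq count_predT size_allpairs !size_iota iter_addr_0 mulr_natl.
  apply: ler_sum => v _; rewrite (ps_translate HQ); last exact: flocal_trifurcation.
  by apply: hd; rewrite /N; clear; nia.
have {h1 h2} h := le_trans h2 h1.
have k1 : (1 : R) <= K.+1%:R by rewrite ler1n.
move: hK; rewrite ltr_pdivrMr // => hK.
have : (4 * (N + N).+1)%:R <= K.+1%:R * (8 * (n + n).+1 + 4)%:R :> R.
  by rewrite -natrM ler_nat /N; clear; nia.
move: h hK; rewrite natrM; set x := K.+1%:R; clear - k1 d0; nra.
Qed.
End no_percolation.

Local Open Scope classical_set_scope.
Local Open Scope ring_scope.

(** * Finite sums over spins *)

Definition upd (sigma : config) (x : vertex) (b : bool) : config :=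
  fun y => if y == x then b else sigma y.

Lemma upd_same sigma x b c : upd (upd sigma x b) x c = upd sigma x c.
Proof. by apply/funext => y; rewrite /upd; case: eqP. Qed.

Lemma upd_comm sigma x y b c : x != y ->
  upd (upd sigma x b) y c = upd (upd sigma y c) x b.
Proof.
move=> xy; apply/funext => z; rewrite /upd; case: eqP => [->|//].
by rewrite eq_sym (negbTE xy).
Qed.

Lemma upd_id (sigma : config) x : upd sigma x (sigma x) = sigma.
Proof. by apply/funext => y; rewrite /upd; case: eqP => [->|]. Qed.

Definition agree (L : seq vertex) (xi : config) : set config :=
  [set sigma | forall x, x \notin L -> sigma x = xi x].

Definition conf_le (sigma tau : config) : Prop := forall x, sigma x -> tau x.
Definition conf_or (sigma tau : config) : config := fun x => sigma x || tau x.
Definition conf_and (sigma tau : config) : config := fun x => sigma x && tau x.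
Definition conf_neg (sigma : config) : config := fun x => ~~ sigma x.

Lemma conf_negK : involutive conf_neg.
Proof. by move=> s; apply/funext => x; rewrite /conf_neg negbK. Qed.

Section finite_sums.
Variable R : realType.
Implicit Types (F G W f g a : config -> R) (L : seq vertex) (sigma tau xi : config).

Definition site_sum (x : vertex) F : config -> R :=
  fun sigma => F (upd sigma x true) + F (upd sigma x false).

(** The sum over the spins in [L], as a function of the spins elsewhere. Unlike a sum
    over a set of configurations, it can be computed one site at a time. *)
Definition conf_sum L F : config -> R := foldr site_sum F L.

Lemma conf_sum_cons x L F sigma : conf_sum (x :: L) F sigma =
  conf_sum L F (upd sigma x true) + conf_sum L F (upd sigma x false).
Proof. by []. Qed.

Lemma conf_sum_cat L L' F : conf_sum (L ++ L') F = conf_sum L (conf_sum L' F).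
Proof. exact: foldr_cat. Qed.

Lemma agree_nil xi : agree [::] xi = [set xi].
Proof.
apply/seteqP; split=> [sigma h|sigma -> //].
by apply/funext => x; apply: h.
Qed.

Lemma agree_cons x L xi : x \notin L ->
  agree (x :: L) xi = agree L (upd xi x true) `|` agree L (upd xi x false).
Proof.
move=> xL; apply/seteqP; split=> sigma.
  move=> h; case: (boolP (sigma x)) => sx; [left|right] => y yL; rewrite /upd;
    case: eqP => [->|/eqP yx]; rewrite ?sx ?(negbTE sx) // h // inE negb_or yx //.
move=> h y; rewrite inE negb_or => /andP[yx yL].
by case: h => ->; rewrite // /upd (negbTE yx).
Qed.

Lemma fsbig_conf_sum L F xi : uniq L ->
  finite_set (agree L xi) /\ \sum_(sigma \in agree L xi) F sigma = conf_sum L F xi.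
Proof.
elim: L xi => [|x L IH] xi; first by rewrite agree_nil fsbig_set1.
move=> /andP[xL uL]; rewrite agree_cons // conf_sum_cons.
have [f1 s1] := IH (upd xi x true) uL; have [f2 s2] := IH (upd xi x false) uL.
split; first by rewrite finite_setU.
rewrite fsbigU //; first by rewrite s1 s2.
move=> sigma [/(_ x xL) h1 /(_ x xL) h2].
by move: h1; rewrite h2 /upd eqxx.
Qed.

Lemma conf_sum_mem L L' F : uniq L -> uniq L' -> L =i L' -> conf_sum L F = conf_sum L' F.
Proof.
move=> uL uL' LL'; apply/funext => xi.
rewrite -(fsbig_conf_sum F xi uL).2 -(fsbig_conf_sum F xi uL').2.
congr (\sum_(sigma \in _) F sigma).
by apply/seteqP; split=> sigma h x hx; apply: h; rewrite ?LL' // -LL'.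
Qed.

Definition indep (V : Type) (L : seq vertex) (a : config -> V) : Prop :=
  forall sigma x b, x \in L -> a (upd sigma x b) = a sigma.

Lemma indep_site_sum x F : indep [:: x] (site_sum x F).
Proof. by move=> sigma y b; rewrite inE => /eqP ->; rewrite /site_sum !upd_same. Qed.

Lemma indep_conf_sum L F : indep L (conf_sum L F).
Proof.
elim: L => [|x L IH] // sigma y b.
have [->|yx] := eqVneq y x; first by move=> _; apply: indep_site_sum; apply: mem_head.
rewrite inE (negbTE yx) orFb => yL.
by rewrite !conf_sum_cons !(@upd_comm sigma y x) // (IH _ _ _ yL) (IH _ _ _ yL).
Qed.

Lemma conf_sum_indep L a F sigma : indep L a ->
  conf_sum L (fun tau => a tau * F tau) sigma = a sigma * conf_sum L F sigma.
Proof.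
elim: L sigma => [|x L IH] sigma ia //.
have iL : indep L a by move=> s y b yL; apply: ia; rewrite inE yL orbT.
by rewrite !conf_sum_cons !IH // !ia ?mem_head // mulrDr.
Qed.

Lemma conf_sumD L F G sigma :
  conf_sum L (fun tau => F tau + G tau) sigma = conf_sum L F sigma + conf_sum L G sigma.
Proof. by elim: L sigma => [|x L IH] sigma //; rewrite !conf_sum_cons !IH addrACA. Qed.

Lemma conf_sum_le L F G sigma : (forall tau, agree L sigma tau -> F tau <= G tau) ->
  conf_sum L F sigma <= conf_sum L G sigma.
Proof.
elim: L sigma => [|x L IH] sigma h; first by apply: h.
have h' b : conf_sum L F (upd sigma x b) <= conf_sum L G (upd sigma x b).
  apply: IH => tau ht; apply: h => y; rewrite inE negb_or => /andP[yx yL].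
  by rewrite ht // /upd (negbTE yx).
by rewrite !conf_sum_cons lerD.
Qed.

Lemma conf_sum_gt0 L F sigma : (forall tau, 0 < F tau) -> 0 < conf_sum L F sigma.
Proof. by move=> h; elim: L sigma => [|x L IH] sigma //; rewrite conf_sum_cons addr_gt0. Qed.

Lemma conf_sum_ge0 L F sigma : (forall tau, 0 <= F tau) -> 0 <= conf_sum L F sigma.
Proof. by move=> h; elim: L sigma => [|x L IH] sigma //; rewrite conf_sum_cons addr_ge0. Qed.

Lemma conf_sum_ge_term L F sigma tau : (forall tau, 0 <= F tau) -> agree L sigma tau ->
  F tau <= conf_sum L F sigma.
Proof.
move=> F0; elim: L sigma => [|x L IH] sigma; first by rewrite agree_nil => ->.
move=> h; rewrite conf_sum_cons.
have : F tau <= conf_sum L F (upd sigma x (tau x)).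
  apply: IH => y yL; rewrite /upd; case: eqP => [->//|/eqP yx].
  by apply: h; rewrite inE negb_or yx yL.
have := conf_sum_ge0 L (upd sigma x true) F0.
have := conf_sum_ge0 L (upd sigma x false) F0.
by case: (tau x); lra.
Qed.

Definition depends_on (V : Type) (K : vertex -> Prop) (F : config -> V) : Prop :=
  forall sigma tau, (forall x, K x -> sigma x = tau x) -> F sigma = F tau.

Lemma conf_sum_depends K L F sigma tau : depends_on K F ->
  (forall x, K x -> x \notin L -> sigma x = tau x) ->
  conf_sum L F sigma = conf_sum L F tau.
Proof.
move=> FK; elim: L sigma tau => [|x L IH] sigma tau h.
  by apply: FK => x Kx; apply: h.
rewrite !conf_sum_cons; congr (_ + _); apply: IH => y Ky yL; rewrite /upd;
  case: eqP => // /eqP yx; apply: h => //; by rewrite inE negb_or yx yL.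
Qed.

(** * The four functions theorem *)

(** With [u := c1 * d0], the mixed terms [p] and [q] are at most [u] and satisfy
    [p * q <= u * (c0 * d1)]; expanding [(u - p) * (u - q) >= 0] bounds their sum. *)
Lemma four_functions_site (a0 a1 b0 b1 c0 c1 d0 d1 : R) :
  0 <= a0 -> 0 <= a1 -> 0 <= b0 -> 0 <= b1 ->
  0 <= c0 -> 0 <= c1 -> 0 <= d0 -> 0 <= d1 ->
  a0 * b0 <= c0 * d0 -> a0 * b1 <= c1 * d0 -> a1 * b0 <= c1 * d0 ->
  a1 * b1 <= c1 * d1 -> (a1 + a0) * (b1 + b0) <= (c1 + c0) * (d1 + d0).
Proof.
move=> a00 a10 b00 b10 c00 c10 d00 d10 h00 h01 h10 h11.
suff : a0 * b1 + a1 * b0 <= c1 * d0 + c0 * d1 by lra.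
set u := c1 * d0 in h01 h10 *; set p := a0 * b1 in h01 *; set q := a1 * b0 in h10 *.
have pq : p * q <= u * (c0 * d1).
  have -> : p * q = (a0 * b0) * (a1 * b1) by rewrite /p /q; ring.
  have -> : u * (c0 * d1) = (c0 * d0) * (c1 * d1) by rewrite /u; ring.
  by apply: ler_pM => //; apply: mulr_ge0.
have p0 : 0 <= p by apply: mulr_ge0.
have q0 : 0 <= q by apply: mulr_ge0.
have w0 : 0 <= c0 * d1 by apply: mulr_ge0.
have [u0|u0] := eqVneq u 0; first by lra.
have {}u0 : 0 < u by rewrite lt_neqAle eq_sym u0 /= mulr_ge0.
rewrite -(ler_pM2l u0).
have : 0 <= (u - p) * (u - q) by apply: mulr_ge0; rewrite subr_ge0.
by clear - pq; lra.
Qed.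

(** The inequality of Ahlswede and Daykin; the hypothesis is preserved by summing over
    one site. *)
Lemma four_functions L (f1 f2 f3 f4 : config -> R) :
  (forall s, 0 <= f1 s) -> (forall s, 0 <= f2 s) ->
  (forall s, 0 <= f3 s) -> (forall s, 0 <= f4 s) ->
  (forall s t, f1 s * f2 t <= f3 (conf_or s t) * f4 (conf_and s t)) ->
  forall s t, conf_sum L f1 s * conf_sum L f2 t <=
    conf_sum L f3 (conf_or s t) * conf_sum L f4 (conf_and s t).
Proof.
move=> p1 p2 p3 p4 h; elim: L => [//|x L IH] s t.
have or_upd b c : conf_or (upd s x b) (upd t x c) = upd (conf_or s t) x (b || c).
  by apply/funext => y; rewrite /conf_or /upd; case: eqP.
have and_upd b c : conf_and (upd s x b) (upd t x c) = upd (conf_and s t) x (b && c).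
  by apply/funext => y; rewrite /conf_and /upd; case: eqP.
rewrite !conf_sum_cons.
apply: four_functions_site; try exact: conf_sum_ge0.
- by have := IH (upd s x false) (upd t x false); rewrite or_upd and_upd.
- by have := IH (upd s x false) (upd t x true); rewrite or_upd and_upd.
- by have := IH (upd s x true) (upd t x false); rewrite or_upd and_upd.
- by have := IH (upd s x true) (upd t x true); rewrite or_upd and_upd.
Qed.

(** * Finite-volume Gibbs kernels *)

Definition gibbs L W f sigma : R :=
  conf_sum L (fun tau => f tau * W tau) sigma / conf_sum L W sigma.

Definition increasing f : Prop := forall s t, conf_le s t -> f s <= f t.

Definition supermodular W : Prop :=
  forall s t, W s * W t <= W (conf_or s t) * W (conf_and s t).

Lemma conf_or_le s t : conf_le s t -> conf_or s t = t.
Proof. by move=> h; apply/funext => x; rewrite /conf_or; have := h x; case: (s x) => // ->. Qed.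

Lemma conf_and_le s t : conf_le s t -> conf_and s t = s.
Proof. by move=> h; apply/funext => x; rewrite /conf_and; have := h x; case: (s x) => // ->. Qed.

Section kernel.
Variables (W : config -> R) (W0 : forall s, 0 < W s) (Wsup : supermodular W).

Let W_ge0 s : 0 <= W s. Proof. exact: ltW. Qed.
Let Z0 L s : 0 < conf_sum L W s. Proof. exact: conf_sum_gt0. Qed.

(** Holley's inequality, as an instance of the four functions theorem. *)
Lemma gibbs_monotone L f s t : (forall s, 0 <= f s) -> increasing f ->
  conf_le s t -> gibbs L W f s <= gibbs L W f t.
Proof.
move=> f0 fi st; rewrite /gibbs ler_pdivrMr // mulrAC ler_pdivlMr //.
have h := @four_functions L (fun s => f s * W s) W (fun s => f s * W s) W _ _ _ _ _ s t.
rewrite conf_or_le // conf_and_le // in h; apply: h => //.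
- by move=> u; rewrite mulr_ge0.
- by move=> u; rewrite mulr_ge0.
- move=> u v; rewrite /= -!mulrA; apply: ler_pM => //; first by rewrite mulr_ge0.
  by apply: fi => x ux; rewrite /conf_or ux.
Qed.

Lemma gibbs_fkg L f g s : (forall s, 0 <= f s) -> (forall s, 0 <= g s) ->
  increasing f -> increasing g ->
  gibbs L W f s * gibbs L W g s <= gibbs L W (fun t => f t * g t) s.
Proof.
move=> f0 g0 fi gi; rewrite /gibbs mulf_div ler_pdivrMr ?mulr_gt0 //.
rewrite mulrA divfK ?gt_eqF //.
have h := @four_functions L (fun s => f s * W s) (fun s => g s * W s)
  (fun s => f s * g s * W s) W _ _ _ _ _ s s.
have e1 : conf_or s s = s by apply: conf_or_le.
have e2 : conf_and s s = s by apply: conf_and_le.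
rewrite e1 e2 in h; apply: h => //.
- by move=> u; rewrite mulr_ge0.
- by move=> u; rewrite mulr_ge0.
- by move=> u; rewrite !mulr_ge0.
- move=> u v; rewrite /= mulrACA -[leRHS]mulrA; apply: ler_pM => //; rewrite ?mulr_ge0 //.
  apply: ler_pM => //; [apply: fi|apply: gi] => x; rewrite /conf_or => -> //.
  by rewrite orbT.
Qed.

Lemma gibbsD L f g s : gibbs L W (fun t => f t + g t) s = gibbs L W f s + gibbs L W g s.
Proof.
rewrite /gibbs -mulrDl -conf_sumD; congr (_ / _).
by congr conf_sum; apply/funext => t; rewrite mulrDl.
Qed.

Lemma gibbs_cst L c s : gibbs L W (fun=> c) s = c.
Proof. by rewrite /gibbs (conf_sum_indep (a := fun=> c)) // mulfK // gt_eqF. Qed.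

Lemma gibbs_sum (I : Type) (r : seq I) L (F : I -> config -> R) s :
  gibbs L W (fun t => \sum_(i <- r) F i t) s = \sum_(i <- r) gibbs L W (F i) s.
Proof.
elim: r => [|i r IH].
  have -> : (fun t => \sum_(j <- [::]) F j t) = (fun=> 0) by apply/funext => t; rewrite big_nil.
  by rewrite big_nil gibbs_cst.
rewrite big_cons -IH -gibbsD; congr gibbs; apply/funext => t; exact: big_cons.
Qed.

Lemma gibbs_indep L a f s : indep L a ->
  gibbs L W (fun t => a t * f t) s = a s * gibbs L W f s.
Proof.
move=> ia; rewrite /gibbs mulrA -conf_sum_indep //; congr (_ / _).
by congr conf_sum; apply/funext => t; rewrite mulrA.
Qed.

Lemma gibbs_le L f g s : (forall t, agree L s t -> f t <= g t) ->
  gibbs L W f s <= gibbs L W g s.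
Proof.
move=> fg; rewrite /gibbs ler_pM2r ?invr_gt0 //; apply: conf_sum_le => t ht.
by rewrite ler_pM2r // fg.
Qed.

(** The DLR equation, for an observable multiplied by an event outside [L]. *)
Lemma gibbs_tower L L' a f s : indep L a ->
  gibbs (L' ++ L) W (fun t => a t * f t) s =
  gibbs (L' ++ L) W (fun t => a t * gibbs L W f t) s.
Proof.
move=> ia; rewrite /gibbs; congr (_ / _); rewrite !conf_sum_cat; congr conf_sum.
apply/funext => t.
have -> : (fun u => a u * f u * W u) = (fun u => a u * (f u * W u)).
  by apply/funext => u; rewrite mulrA.
have -> : (fun u => a u * (conf_sum L (fun v => f v * W v) u / conf_sum L W u) * W u)
    = (fun u => a u * ((conf_sum L (fun v => f v * W v) u / conf_sum L W u) * W u)).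
  by apply/funext => u; rewrite -[LHS]mulrA.
pose q u := conf_sum L (fun v => f v * W v) u / conf_sum L W u.
have iq : indep L q.
  by move=> u x b xL; rewrite /q !(indep_conf_sum _ _ _ xL).
rewrite !(conf_sum_indep (a := a)) // (conf_sum_indep (a := q)) // /q divfK //.
by rewrite gt_eqF.
Qed.

End kernel.

Lemma gibbs_mem L L' W f : uniq L -> uniq L' -> L =i L' -> gibbs L W f = gibbs L' W f.
Proof.
by move=> uL uL' LL'; apply/funext => s; rewrite /gibbs !(conf_sum_mem _ uL uL' LL').
Qed.

(** Spatial Markov property: the factor [V] cancels in the quotient. *)
Lemma gibbs_factor L W V f s : (forall t, 0 < V t) -> indep L V ->
  gibbs L (fun t => V t * W t) f s = gibbs L W f s.
Proof.
move=> V0 iV; rewrite /gibbs.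
have -> : (fun t => f t * (V t * W t)) = (fun t => V t * (f t * W t)).
  by apply/funext => t; rewrite mulrCA.
by rewrite !(conf_sum_indep (a := V)) // -mulf_div divff ?mul1r // gt_eqF.
Qed.

Lemma gibbs_depends K L W f s t : depends_on K f -> depends_on K W ->
  (forall x, K x -> x \notin L -> s x = t x) -> gibbs L W f s = gibbs L W f t.
Proof.
move=> fK WK st; rewrite /gibbs (conf_sum_depends WK st); congr (_ / _).
apply: (@conf_sum_depends K) => // u v uv; by rewrite (fK u v) ?(WK u v).
Qed.

Section symmetry.
Variables (g g' : vertex -> vertex) (gK : cancel g g') (g'K : cancel g' g).

Definition pullback sigma : config := fun x => sigma (g x).

Lemma upd_pullback sigma x b : pullback (upd sigma (g x) b) = upd (pullback sigma) x b.
Proof.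
apply/funext => y; rewrite /pullback /upd (inj_eq (can_inj gK)) //.
Qed.

Lemma conf_sum_pullback L F sigma :
  conf_sum (map g L) (F \o pullback) sigma = conf_sum L F (pullback sigma).
Proof.
elim: L sigma => [|x L IH] sigma //.
by rewrite map_cons !conf_sum_cons !IH !upd_pullback.
Qed.

Lemma gibbs_pullback L W f sigma :
  gibbs (map g L) (W \o pullback) (f \o pullback) sigma = gibbs L W f (pullback sigma).
Proof. by rewrite /gibbs -!conf_sum_pullback. Qed.

End symmetry.

Lemma upd_neg sigma x b : conf_neg (upd sigma x b) = upd (conf_neg sigma) x (~~ b).
Proof. by apply/funext => y; rewrite /conf_neg /upd; case: eqP. Qed.

Lemma conf_sum_neg L F sigma : conf_sum L (F \o conf_neg) sigma = conf_sum L F (conf_neg sigma).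
Proof.
elim: L sigma => [|x L IH] sigma //.
by rewrite !conf_sum_cons !IH !upd_neg addrC.
Qed.

Lemma gibbs_neg L W f sigma : W \o conf_neg = W ->
  gibbs L W (f \o conf_neg) sigma = gibbs L W f (conf_neg sigma).
Proof.
move=> WN; rewrite /gibbs -!conf_sum_neg WN; congr (_ / _).
by congr conf_sum; apply/funext => t; rewrite /= -[in LHS]WN.
Qed.

End finite_sums.

(** * Ising kernels on the slab *)

(** All three layers of a column are pairwise adjacent, so that every permutation of
    the layers is a symmetry. *)
Lemma adjE (c d : col) (k l : 'I_3) :
  adj (c, k) (d, l) = (c == d) && (k != l) || col_adj c d && (k == l).
Proof.
case: c d => [a b] [a' b'].
have cases : adj ((a, b), k) ((a', b'), l) <->
    (a = a' /\ b = b' /\ k <> l) \/ (col_adj (a, b) (a', b') /\ k = l).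
  rewrite /adj; split.
    case/orP => [/eqP h|/and3P[/eqP -> /eqP ->]]; last first.
      by move=> h; left; split=> //; split=> // kl; move: h; rewrite kl;
        case: (nat_of_ord l) => [|[|[]]].
    have [e|ne] := eqVneq k l.
      by right; split=> //; apply/eqP; move: h; rewrite e subrr expr0n addr0.
    left; have : (k%:Z - l%:Z != 0).
      by rewrite subr_eq0; apply: contraNneq ne => -[e]; apply/eqP/val_inj.
    set z := k%:Z - l%:Z in h *; move=> z0; move: h z0; clearbody z => h z0.
    have h1 : a - a' = 0 by nia.
    have h2 : b - b' = 0 by nia.
    by split; [lia | split; [lia | exact/eqP]].
  case=> [[-> [-> kl]]|[cd ->]]; last first.
    by apply/orP; left; rewrite subrr expr0n addr0; exact: cd.
  apply/orP; rewrite !subrr !eqxx add0r /=.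
  case: k l kl => -[|[|[|//]]] hk [[|[|[|//]]] hl] //= kl;
    try (by left); try (by right); by case: kl; apply: val_inj.
apply/idP/idP => [/cases[[-> [-> /eqP kl]]|[cd ->]]|].
- by rewrite eqxx kl.
- by rewrite cd eqxx orbT.
- move=> h; apply/cases; case/orP: h => /andP[]; first by move=> /eqP[-> ->] /eqP kl; left.
  by move=> cd /eqP ->; right.
Qed.

Lemma adj_sym x y : adj x y = adj y x.
Proof.
case: x y => [c k] [d l]; rewrite !adjE eq_sym [k == l]eq_sym; congr (_ || _ && _).
by apply/idP/idP; apply: col_adj_sym.
Qed.

Definition neighbours (x : vertex) : seq vertex :=
  [:: ((x.1.1 + 1, x.1.2), x.2); ((x.1.1 - 1, x.1.2), x.2);
      ((x.1.1, x.1.2 + 1), x.2); ((x.1.1, x.1.2 - 1), x.2)] ++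
  [seq (x.1, l) | l <- enum 'I_3].

Lemma adj_neighbours x y : adj x y -> y \in neighbours x.
Proof.
case: x y => [[a b] k] [[a' b'] l]; rewrite adjE => /orP[/andP[/eqP[-> ->] _]|].
  rewrite /neighbours mem_cat; apply/orP; right; apply/mapP; by exists l; rewrite ?mem_enum.
move=> /andP[/col_adjP /= h /eqP ->]; rewrite /neighbours mem_cat; apply/orP; left.
rewrite !inE -!pair_eqE /= !eqxx !andbT -!pair_eqE /=; clear - h; lia.
Qed.

Section ising.
Variables (R : realType) (beta : R).
Implicit Types (L K : seq vertex) (f : config -> R).

Definition edges (X : set vertex) : set (vertex * vertex) :=
  [set e | adj e.1 e.2 /\ (X e.1 \/ X e.2)].

Definition bond (sigma : config) (e : vertex * vertex) : R :=
  spin (sigma e.1) * spin (sigma e.2).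

Definition energy (X : set vertex) (sigma : config) : R :=
  2^-1 * \sum_(e \in edges X) bond sigma e.

Definition ising_weight L (sigma : config) : R := expR (beta * energy [set` L] sigma).

Lemma finite_edges L : finite_set (edges [set` L]).
Proof.
pose L' := L ++ flatten (map neighbours L).
apply: (@sub_finite_set _ _ ([set` L'] `*` [set` L'])); last first.
  by apply: finite_setX; apply: finite_seq.
have nb x y : x \in L -> adj x y -> y \in L'.
  move=> xL /adj_neighbours h; rewrite mem_cat; apply/orP; right.
  by apply/flattenP; exists (neighbours x) => //; apply: map_f.
move=> [x y] /= [xy [h|h]]; split=> /=.
- by rewrite mem_cat h.
- exact: nb xy.
- by apply: nb h _; rewrite adj_sym.
- by rewrite mem_cat h.
Qed.

Lemma ising_weight_gt0 L sigma : 0 < ising_weight L sigma. Proof. exact: expR_gt0. Qed.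

Lemma spin_neg (b : bool) : spin (~~ b) = - spin b :> R.
Proof. by case: b; rewrite /spin ?opprK. Qed.

Lemma ising_weight_neg L : ising_weight L \o conf_neg = ising_weight L.
Proof.
apply/funext => s; rewrite /ising_weight /energy /=; congr (expR (_ * (_ * _))).
by apply: eq_fsbigr => e _; rewrite /bond /conf_neg !spin_neg mulrNN.
Qed.

(** Ferromagnetism: each bond is supermodular. *)
Lemma ising_weight_supermodular L : 0 <= beta -> supermodular (ising_weight L).
Proof.
move=> b0 s t; rewrite /ising_weight -!expRD ler_expR -!mulrDr.
apply: ler_wpM2l => //; rewrite ler_pM2l ?invr_gt0 //.
rewrite !(fsbig_finite _ _ (finite_edges L)) /= -!big_split /=.
apply: ler_sum => -[x y] _; rewrite /bond /conf_or /conf_and /spin /=.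
by case: (s x); case: (s y); case: (t x); case: (t y) => /=; lra.
Qed.

Lemma ising_weight_depends L : depends_on (fun x => x \in L \/ exists2 y, y \in L & adj x y)
  (ising_weight L).
Proof.
move=> s t st; rewrite /ising_weight /energy; congr (expR (_ * (_ * _))).
apply: eq_fsbigr => -[x y]; rewrite inE => -[/= xy h]; rewrite /bond /=.
congr (spin _ * spin _); apply: st; case: h => h; [by left| |  |by left].
- by right; exists y.
- by right; exists x; rewrite // adj_sym.
Qed.

(** The edges that do not meet [L] contribute a factor that does not involve its
    spins. *)
Lemma ising_weight_factor L L' : {subset L <= L'} ->
  exists V : config -> R, [/\ forall s, 0 < V s, indep L V &
    ising_weight L' = (fun s => V s * ising_weight L s)].
Proof.
move=> LL'.
pose E := edges [set` L'] `&` ~` edges [set` L].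
exists (fun s => expR (beta * (2^-1 * \sum_(e \in E) bond s e))); split.
- by move=> s; apply: expR_gt0.
- move=> s x b xL; congr (expR (_ * (_ * _))); apply: eq_fsbigr => -[y z].
  rewrite inE => -[[/= yz _] nE]; rewrite /bond /upd /=.
  case: eqP => [yx|_]; first by case: nE; split=> //=; left; rewrite yx.
  by case: eqP => [zx|_] //; case: nE; split=> //=; right; rewrite zx.
- apply/funext => s; rewrite /ising_weight -expRD -mulrDr; congr (expR (_ * _)).
  rewrite /energy -mulrDr; congr (_ * _).
  have -> : \sum_(e \in edges [set` L']) bond s e =
      \sum_(e \in edges [set` L'] `&` edges [set` L]) bond s e + \sum_(e \in E) bond s e.
    exact: fsbigID (finite_edges L').
  rewrite addrC; congr (_ + _).
  have -> // : edges [set` L'] `&` edges [set` L] = edges [set` L].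
  apply/seteqP; split=> [e []//|e h]; split=> //.
  by case: h => he h; split=> //; case: h => h; [left|right]; apply: LL'.
Qed.

Definition ising_mean L f : config -> R := gibbs L (ising_weight L) f.

Lemma gibbs_ising_weight L L' f sigma : {subset L <= L'} ->
  gibbs L (ising_weight L') f sigma = ising_mean L f sigma.
Proof. by move=> /ising_weight_factor[V [V0 iV ->]]; apply: gibbs_factor. Qed.

Lemma ising_mean_tower L L' (a f : config -> R) sigma : uniq L -> uniq L' -> {subset L <= L'} ->
  indep L a ->
  ising_mean L' (fun t => a t * f t) sigma = ising_mean L' (fun t => a t * ising_mean L f t) sigma.
Proof.
move=> uL uL' LL' ia; pose M := [seq x <- L' | x \notin L] ++ L.
have uM : uniq M.
  rewrite cat_uniq filter_uniq // uL andbT /=; apply/hasPn => x xL.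
  by rewrite mem_filter xL.
have ML : L' =i M.
  move=> x; rewrite mem_cat mem_filter; case: (boolP (x \in L)) => [/LL' ->//|_].
  by rewrite orbF.
have -> : ising_mean L f = gibbs L (ising_weight L') f by apply/funext => t;
  rewrite gibbs_ising_weight.
rewrite /ising_mean (gibbs_mem (ising_weight L') (fun t => a t * f t) uL' uM ML).
rewrite (gibbs_mem (ising_weight L') (fun t => a t * gibbs L (ising_weight L') f t) uL' uM ML).
by apply: gibbs_tower => //; exact: ising_weight_gt0.
Qed.

Lemma ising_mean_neg L f sigma : ising_mean L (f \o conf_neg) sigma =
  ising_mean L f (conf_neg sigma).
Proof. by apply: gibbs_neg; apply: ising_weight_neg. Qed.

Lemma ising_mean_pullback L f sigma (g g' : vertex -> vertex) : cancel g g' -> cancel g' g ->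
  (forall x y, adj (g x) (g y) = adj x y) ->
  ising_mean (map g L) (f \o pullback g) sigma = ising_mean L f (pullback g sigma).
Proof.
move=> gK g'K ga; rewrite /ising_mean -(gibbs_pullback (g := g) (g' := g') gK); congr gibbs.
apply/funext => s; rewrite /ising_weight /energy /=; congr (expR (_ * (_ * _))).
have adjg x y : adj x y = adj (g' x) (g' y) by rewrite -{1}(g'K x) -{1}(g'K y) ga.
rewrite (reindex_fsbig (fun e : vertex * vertex => (g e.1, g e.2)) (edges [set` L])) //.
split.
- move=> [x y] /= [xy h]; split=> /=; first by rewrite ga.
  by case: h => h; [left|right]; apply: map_f.
- move=> [x y] [x' y'] _ _ [/(can_inj gK) e1 /(can_inj gK) e2].
  by move: e1 e2 => /= -> ->.
- move=> [x y] /= [xy h]; exists (g' x, g' y); last by rewrite /= !g'K.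
  split=> /=; first by rewrite -adjg.
  by move: h => /= [] /mapP[z zL ->]; [left|right]; rewrite gK.
Qed.

Hypothesis beta0 : 0 <= beta.

Lemma ising_mean_monotone L f s t : (forall s, 0 <= f s) -> increasing f ->
  conf_le s t -> ising_mean L f s <= ising_mean L f t.
Proof. by apply: gibbs_monotone; [exact: ising_weight_gt0|exact: ising_weight_supermodular]. Qed.

Lemma ising_mean_fkg L f g s : (forall s, 0 <= f s) -> (forall s, 0 <= g s) ->
  increasing f -> increasing g -> ising_mean L f s * ising_mean L g s <=
    ising_mean L (fun t => f t * g t) s.
Proof. by apply: gibbs_fkg; [exact: ising_weight_gt0|exact: ising_weight_supermodular]. Qed.

End ising.

(** * Square boxes *)

Definition sqbox (v : col) (n : nat) : box :=
  ((v.1 - n%:Z, v.2 - n%:Z), (v.1 + n%:Z, v.2 + n%:Z)).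

Definition col_box (n : nat) : seq col :=
  [seq (i, j) | i <- interval_seq n, j <- interval_seq n].

Lemma mem_col_box n c : (c \in col_box n) = (cnorm c <= n)%N.
Proof.
case: c => a b; apply/allpairsP/idP => [[[i j] [/= hi hj [-> ->]]]|h].
  by move: hi hj; rewrite !mem_interval_seq /cnorm /= geq_max => -> ->.
by exists (a, b); rewrite /= !mem_interval_seq; move: h; rewrite /cnorm /= geq_max => /andP[].
Qed.

Lemma col_box_uniq n : uniq (col_box n).
Proof. by apply: allpairs_uniq; rewrite ?interval_seq_uniq // => -[? ?] [? ?]. Qed.

Definition lift_cols (D : seq col) : seq vertex := [seq (c, k) | c <- D, k <- enum 'I_3].

Lemma mem_lift_cols D (x : vertex) : (x \in lift_cols D) = (x.1 \in D).
Proof.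
case: x => c k; apply/allpairsP/idP => [[[d l] [/= hd _ [-> _]]] //|h].
by exists (c, k); rewrite /= mem_enum.
Qed.

Lemma lift_cols_uniq D : uniq D -> uniq (lift_cols D).
Proof. by move=> uD; apply: allpairs_uniq; rewrite ?enum_uniq // => -[? ?] [? ?]. Qed.

Definition box_at (v : col) (n : nat) : seq vertex :=
  lift_cols (map (translate v) (col_box n)).

Lemma translateK v : cancel (translate v) (untranslate v).
Proof. by case=> a b; rewrite /translate /untranslate /= !addrK. Qed.

Lemma untranslateK v : cancel (untranslate v) (translate v).
Proof. by case=> a b; rewrite /translate /untranslate /= !subrK. Qed.

Lemma mem_box_at v n (x : vertex) : (x \in box_at v n) = (cnorm (untranslate v x.1) <= n)%N.
Proof.
rewrite mem_lift_cols -mem_col_box -[in LHS](untranslateK v x.1).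
by rewrite (mem_map (can_inj (translateK v))).
Qed.

Lemma box_at_uniq v n : uniq (box_at v n).
Proof. by rewrite lift_cols_uniq // (map_inj_uniq (can_inj (translateK v))) col_box_uniq. Qed.

Lemma volume_sqbox v n : volume (sqbox v n) = [set` box_at v n].
Proof.
apply/seteqP; split=> -[[a b] k]; rewrite /volume /in_box /sqbox /= mem_box_at;
  rewrite /untranslate /cnorm /=; case: v => v1 v2 /=; clear; lia.
Qed.

Lemma ising_expectationE (R : realType) (beta : R) s v n f :
  ising_expectation beta s (sqbox v n) f = ising_mean beta (box_at v n) f (fun=> s).
Proof.
have bcE : bc_configs s (sqbox v n) = agree (box_at v n) (fun=> s).
  rewrite /bc_configs volume_sqbox; apply/seteqP; split=> sigma h x hx; apply: h.
    by move=> /= xB; rewrite xB in hx.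
  exact/negP.
have wE : weight beta (sqbox v n) = ising_weight beta (box_at v n).
  by apply/funext => sigma; rewrite /weight /interaction volume_sqbox.
rewrite /ising_expectation bcE wE /ising_mean /gibbs.
by rewrite !(fsbig_conf_sum _ _ (box_at_uniq v n)).2.
Qed.

(** * The plus state in infinite volume *)

Lemma lim_uniq (R : realType) (u : nat -> R) (a b : R) :
  (u n @[n --> \oo] --> a) -> (u n @[n --> \oo] --> b) -> a = b.
Proof. by move=> ha hb; rewrite -(cvg_lim (@Rhausdorff R) ha) (cvg_lim (@Rhausdorff R) hb). Qed.

(** Locality of functions of the spins is measured by finite sets of vertices, which
    symmetries of the graph map to each other. *)
Definition vlocal (V : Type) (f : config -> V) : Prop :=
  exists K : seq vertex, depends_on (fun x => x \in K) f.

Lemma vlocal_comp (U V : Type) (h : U -> V) (f : config -> U) :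
  vlocal f -> vlocal (fun s => h (f s)).
Proof. by move=> [K hK]; exists K => s t st; rewrite (hK s t). Qed.

Lemma vlocal_comp2 (U V W : Type) (h : U -> V -> W) (f : config -> U) (g : config -> V) :
  vlocal f -> vlocal g -> vlocal (fun s => h (f s) (g s)).
Proof.
move=> [K hK] [L hL]; exists (K ++ L) => s t st.
by rewrite (hK s t) ?(hL s t) // => x xK; apply: st; rewrite mem_cat xK ?orbT.
Qed.

Lemma vlocal_cst (V : Type) (v : V) : vlocal (fun=> v).
Proof. by exists [::]. Qed.

Lemma vlocal_at x : vlocal (fun s => s x).
Proof. by exists [:: x] => s t ->; rewrite ?mem_head. Qed.

Definition majority (sigma : config) : pred col := fun c => 0 < col_sum sigma c.

Lemma sum_layers (V : nmodType) (F : 'I_3 -> V) :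
  \sum_(k < 3) F k = F ord0 + F (inord 1) + F (inord 2).
Proof.
rewrite !big_ord_recl big_ord0 addr0 addrA.
by congr (_ + F _ + F _); apply: val_inj; rewrite /= inordK.
Qed.

Lemma majorityE sigma c : majority sigma c =
  [|| sigma (c, ord0) && sigma (c, inord 1), sigma (c, ord0) && sigma (c, inord 2)
    | sigma (c, inord 1) && sigma (c, inord 2)].
Proof.
rewrite /majority /col_sum sum_layers.
by case: (sigma (c, ord0)); case: (sigma (c, inord 1)); case: (sigma (c, inord 2)).
Qed.

Lemma majority_le s t : conf_le s t -> forall c, majority s c -> majority t c.
Proof.
move=> st c; rewrite !majorityE.
have := st (c, ord0); have := st (c, inord 1); have := st (c, inord 2).
by do 3!case: (s _) => [/(_ isT) ->|_] //; rewrite ?orbT ?andbT ?orTb //= ?orbT.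
Qed.

Lemma majority_neg s : majority (conf_neg s) = predC (majority s).
Proof.
apply/funext => c; rewrite /= !majorityE /conf_neg.
by case: (s (c, ord0)); case: (s (c, inord 1)); case: (s (c, inord 2)).
Qed.

Lemma majority_eq s t c : (forall k, s (c, k) = t (c, k)) -> majority s c = majority t c.
Proof. by move=> h; rewrite !majorityE !h. Qed.

Lemma vlocal_majority (V : Type) (f : pred col -> V) :
  flocal f -> vlocal (fun s => f (majority s)).
Proof.
move=> [n hn]; exists (box_at (0, 0) n) => s t st; apply: hn => c hc.
apply: majority_eq => k; apply: st; rewrite mem_box_at /untranslate /= !subr0.
by case: (c) hc.
Qed.

Definition vmap (g : col -> col) (h : 'I_3 -> 'I_3) (x : vertex) : vertex := (g x.1, h x.2).

Lemma adj_vmap g h x y : injective g -> injective h ->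
  (forall c d, col_adj (g c) (g d) = col_adj c d) ->
  adj (vmap g h x) (vmap g h y) = adj x y.
Proof.
move=> gi hi ga; case: x y => [c k] [d l].
by rewrite /vmap !adjE ga (inj_eq gi) (inj_eq hi).
Qed.

Section plus_state.
Variables (R : realType) (beta : R) (P : (config -> R) -> R).

(** What is kept of the plus state: its values on local functions, as limits along
    boxes around any centre, which gives translation invariance. *)
Definition is_plus_limit := forall (f : config -> R) v, vlocal f ->
  ising_mean beta (box_at v n) f (fun=> true) @[n --> \oo] --> P f.

Hypotheses (beta0 : 0 <= beta) (Plim : is_plus_limit).

Let plus_mean n f := ising_mean beta (box_at (0, 0) n) f (fun=> true).
Let minus_mean n f := ising_mean beta (box_at (0, 0) n) f (fun=> false).

Lemma state_le f g : vlocal f -> vlocal g ->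
  (\forall n \near \oo, plus_mean n f <= plus_mean n g) -> P f <= P g.
Proof. by move=> lf lg; apply: ler_cvg_to; apply: Plim. Qed.

Lemma state_mono f g : vlocal f -> vlocal g -> (forall s, f s <= g s) -> P f <= P g.
Proof.
move=> lf lg fg; apply: state_le => //; near=> n; apply: gibbs_le; first exact: ising_weight_gt0.
by move=> t _.
Unshelve. all: by end_near. Qed.

Lemma state_cst c : P (fun=> c) = c.
Proof.
apply: (lim_uniq ((Plim (0, 0) (vlocal_cst c)))).
have -> : (fun n => ising_mean beta (box_at (0, 0) n) (fun=> c) (fun=> true)) = (fun=> c).
  by apply/funext => n; apply: gibbs_cst; exact: ising_weight_gt0.
exact: cvg_cst.
Qed.

Lemma stateD f g : vlocal f -> vlocal g -> P (fun s => f s + g s) = P f + P g.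
Proof.
move=> lf lg.
apply: (lim_uniq ((Plim (0, 0) (vlocal_comp2 _ lf lg)))).
have -> : (fun n => ising_mean beta (box_at (0, 0) n) (fun s => f s + g s) (fun=> true))
    = (fun n => plus_mean n f + plus_mean n g).
  by apply/funext => n; apply: gibbsD.
by apply: cvgD; apply: Plim.
Qed.

Lemma stateZ c f : vlocal f -> P (fun s => c * f s) = c * P f.
Proof.
move=> lf.
apply: (lim_uniq ((Plim (0, 0) (vlocal_comp _ lf)))).
have -> : (fun n => ising_mean beta (box_at (0, 0) n) (fun s => c * f s) (fun=> true))
    = (fun n => c * plus_mean n f).
  by apply/funext => n; apply: gibbs_indep.
by apply: cvgMr; apply: Plim.
Qed.

Lemma state_fkg f g : vlocal f -> vlocal g -> (forall s, 0 <= f s) -> (forall s, 0 <= g s) ->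
  increasing f -> increasing g -> P f * P g <= P (fun s => f s * g s).
Proof.
move=> lf lg f0 g0 fi gi.
have c1 : plus_mean n f * plus_mean n g @[n --> \oo] --> P f * P g by apply: cvgM; apply: Plim.
have c2 := Plim (0, 0) (vlocal_comp2 (fun a b => a * b) lf lg).
apply: (ler_cvg_to c1 c2); near=> n; exact: ising_mean_fkg.
Unshelve. all: by end_near. Qed.

(** The image boxes exhaust the graph as well. *)
Lemma state_sym f (g g' : vertex -> vertex) v : vlocal f ->
  cancel g g' -> cancel g' g -> (forall x y, adj (g x) (g y) = adj x y) ->
  (forall n x, (g x \in box_at v n) = (x \in box_at (0, 0) n)) ->
  P (f \o pullback g) = P f.
Proof.
move=> lf gK g'K ga gbox.
have lfg : vlocal (f \o pullback g).
  have [K hK] := lf; exists (map g K) => s t st; apply: hK => x xK.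
  by apply: st; apply: map_f.
apply: (lim_uniq ((Plim v lfg))).
have -> : (fun n => ising_mean beta (box_at v n) (f \o pullback g) (fun=> true)) =
  (fun n => plus_mean n f).
  apply/funext => n; rewrite /plus_mean -[RHS](ising_mean_pullback beta (box_at (0, 0) n) f
    (fun=> true) gK g'K ga).
  have uM : uniq (map g (box_at (0, 0) n)) by rewrite map_inj_uniq ?box_at_uniq //;
    exact: can_inj gK.
  have bE : box_at v n =i map g (box_at (0, 0) n).
    by move=> x; rewrite -[in LHS](g'K x) gbox -{2}(g'K x) (mem_map (can_inj gK)).
  rewrite /ising_mean (gibbs_mem _ _ (box_at_uniq v n) uM bE).
  have -> // : ising_weight beta (box_at v n) = ising_weight beta (map g (box_at (0, 0) n)).
  apply/funext => s; rewrite /ising_weight; have -> // : [set` box_at v n] =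
    [set` map g (box_at (0, 0) n)].
  by apply/seteqP; split=> x /=; rewrite bE.
exact: Plim.
Qed.

Lemma state_translate f v : vlocal f ->
  P (f \o pullback (vmap (translate v) id)) = P f.
Proof.
move=> lf; apply: (@state_sym _ _ (vmap (untranslate v) id) v) => //.
- by case=> c k; rewrite /vmap /= translateK.
- by case=> c k; rewrite /vmap /= untranslateK.
- move=> x y; apply: adj_vmap => //; first exact: can_inj (translateK v).
  move=> c d; apply/idP/idP; last exact: translate_adj.
  by move=> /col_adjP h; apply/col_adjP; move: h; rewrite /=; clear; lia.
- move=> n [c k]; rewrite !mem_box_at /vmap /= translateK.
  by rewrite /untranslate /= !subr0; case: c.
Qed.

Lemma state_column_sym f g g' : vlocal f -> cancel g g' -> cancel g' g ->
  (forall c d, col_adj c d -> col_adj (g c) (g d)) ->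
  (forall c d, col_adj c d -> col_adj (g' c) (g' d)) ->
  (forall c, cnorm (g c) = cnorm c) -> P (f \o pullback (vmap g id)) = P f.
Proof.
move=> lf gK g'K ga ga' gn; apply: (@state_sym _ _ (vmap g' id) (0, 0)) => //.
- by case=> c k; rewrite /vmap /= gK.
- by case=> c k; rewrite /vmap /= g'K.
- move=> x y; apply: adj_vmap => //; first exact: can_inj gK.
  move=> c d; apply/idP/idP; last exact: ga.
  by move=> /ga'; rewrite !gK.
- move=> n [c k]; rewrite !mem_box_at /vmap /= /untranslate /= !subr0.
  by move: (gn c); case: (g c) => ? ?; case: (c) => ? ? /= ->.
Qed.

Lemma state_layer_sym f (h h' : 'I_3 -> 'I_3) : vlocal f -> cancel h h' -> cancel h' h ->
  P (f \o pullback (vmap id h)) = P f.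
Proof.
move=> lf hK h'K; apply: (@state_sym _ _ (vmap id h') (0, 0)) => //.
- by case=> c k; rewrite /vmap /= hK.
- by case=> c k; rewrite /vmap /= h'K.
- by move=> x y; apply: adj_vmap => //; exact: can_inj hK.
- by move=> n [c k]; rewrite !mem_box_at.
Qed.

Definition up (x : vertex) : config -> R := fun s => (s x)%:R.

Lemma vlocal_up x : vlocal (up x).
Proof. exact: (vlocal_comp (fun b : bool => b%:R)) (vlocal_at x). Qed.

(** Translations and the cyclic group of layers act transitively on the vertices. *)
Lemma state_up x : P (up x) = P (up origin).
Proof.
case: x => c k.
have e1 : up (c, k) = (up ((0, 0), k)) \o pullback (vmap (translate c) id).
  apply/funext => s; rewrite /up /pullback /vmap /translate /= !add0r.
  by case: c.
pose h (l : 'I_3) := l - k.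
have hK : cancel h (fun l => l + k) by move=> l; rewrite /h subrK.
have h'K : cancel (fun l => l + k) h by move=> l; rewrite /h addrK.
have e2 : up ((0, 0), k) = up origin \o pullback (vmap id (fun l => l + k)).
  by apply/funext => s; rewrite /up /pullback /vmap /origin /= add0r.
rewrite e1 state_translate; last exact: vlocal_up.
rewrite e2 (state_layer_sym _ h'K hK) //; exact: vlocal_up.
Qed.

Lemma minus_mean_neg n f : minus_mean n f = plus_mean n (f \o conf_neg).
Proof. by rewrite /plus_mean ising_mean_neg. Qed.

Lemma vlocal_neg (f : config -> R) : vlocal f -> vlocal (f \o conf_neg).
Proof.
by move=> [K hK]; exists K => s t st; apply: hK => x xK; rewrite /conf_neg st.
Qed.

Lemma minus_mean_up n x : minus_mean n (up x) = 1 - plus_mean n (up x).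
Proof.
rewrite minus_mean_neg; apply/eqP; rewrite eq_sym subr_eq eq_sym; apply/eqP.
rewrite -gibbsD -[RHS](@gibbs_cst _ _ (ising_weight_gt0 beta (box_at (0, 0) n)) (box_at (0, 0)
  n) 1 (fun=> true)).
congr gibbs; apply/funext => s; rewrite /up /= /conf_neg.
by case: (s x); rewrite ?addr0 ?add0r.
Qed.

Lemma minus_mean_le n f : (forall s, 0 <= f s) -> increasing f -> minus_mean n f <= plus_mean n f.
Proof. by move=> f0 fi; apply: ising_mean_monotone. Qed.

Section unmagnetized.
Hypothesis half : P (up origin) = 2^-1.

(** If [f] depends on the spins in [K] and takes values between 0 and [C], then [C] times
    the number of plus spins in [K], minus [f], is increasing. So the gap between the
    plus and minus means of [f] is at most [C] times the sum of the gaps of the spins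
    in [K], which vanish in the limit. *)
Lemma minus_limit (f : config -> R) : vlocal f -> (forall s, 0 <= f s) -> increasing f ->
  minus_mean n f @[n --> \oo] --> P f.
Proof.
move=> lf f0 fi; have [K hK] := lf.
pose C := f (fun=> true).
have fC s : f s <= C by apply: fi.
pose S : config -> R := fun s => \sum_(x <- K) up x s.
pose d n := plus_mean n S - minus_mean n S.
have S_le s t : conf_le s t -> S s <= S t.
  move=> st; apply: ler_sum => x _; rewrite /up ler_nat.
  by have := st x; case: (s x) => // ->.
have S_strict s t : conf_le s t -> f s = f t \/ S s + 1 <= S t.
  move=> st; have [h|h] := pselect (forall x : vertex, x \in K -> s x = t x); first by left;
    apply: hK.
  have [x xK sx] : exists2 x : vertex, x \in K & s x <> t x.
    by apply: contrapT => nh; apply: h => x xK; apply: contrapT => ne; apply: nh; exists x.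
  right; rewrite /S !(big_rem x xK) /=.
  have hx : up x s + 1 <= up x t.
    have hst := st x; move: sx hst; rewrite /up.
    case: (s x); case: (t x) => /= sx hst.
    - by case: sx.
    - by have := hst isT.
    - by rewrite add0r.
    - by case: sx.
  have : \sum_(y <- rem x K) up y s <= \sum_(y <- rem x K) up y t.
    apply: ler_sum => y _; rewrite /up ler_nat.
    by have := st y; case: (s y) => // ->.
  by move: hx; lra.
have SR (s : config) : 0 <= S s by apply: sumr_ge0 => x _; rewrite ler0n.
have C0 : 0 <= C by apply: f0.
pose g := fun s => C * S s + (C - f s).
have g0 s : 0 <= g s by rewrite addr_ge0 ?mulr_ge0 // subr_ge0.
have gi : increasing g.
  move=> s t st; rewrite /g.
  have [e|h] := S_strict s t st.
    by rewrite e lerD2r ler_wpM2l // S_le.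
  have := ler_wpM2l C0 h; rewrite mulrDr mulr1.
  by have := f0 s; have := fC t; have := f0 t; lra.
have EfD n xi : ising_mean beta (box_at (0, 0) n) g xi + ising_mean beta (box_at (0, 0) n) f xi =
    C * ising_mean beta (box_at (0, 0) n) S xi + C.
  rewrite -gibbsD.
  rewrite -(gibbs_indep (ising_weight beta (box_at (0, 0) n)) (a := fun=> C)) //.
  rewrite -[X in _ = _ + X](@gibbs_cst _ _ (ising_weight_gt0 beta (box_at (0, 0) n)) (box_at
    (0, 0) n) C xi) -gibbsD.
  by congr gibbs; apply/funext => s; rewrite /g; ring.
have ES n xi : ising_mean beta (box_at (0, 0) n) S xi =
  \sum_(x <- K) ising_mean beta (box_at (0, 0) n) (up x) xi.
  by apply: gibbs_sum; exact: ising_weight_gt0.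
have d0 : d n @[n --> \oo] --> (0 : R).
  have -> : d = (fun n => \sum_(x <- K) (plus_mean n (up x) + plus_mean n (up x) - 1)).
    apply/funext => n; rewrite /d /plus_mean /minus_mean !ES -sumrB; apply: eq_bigr => x _.
    by have := minus_mean_up n x; rewrite /minus_mean /plus_mean => ->; ring.
  rewrite -[X in _ --> X](@big1_eq R 0 +%R _ K predT).
  apply: cvg_big => [|x _]; first exact: add_continuous.
  have : P (up x) + P (up x) - 1 = 0 by rewrite state_up half; lra.
  move=> <-; apply: cvgB; last exact: cvg_cst.
  by apply: cvgD; apply: Plim; exact: vlocal_up.
have lo : plus_mean n f - C * d n @[n --> \oo] --> P f.
  rewrite -[X in _ --> X]subr0 -(mulr0 C); apply: cvgB; first exact: Plim.
  exact: cvgMr d0.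
apply: (squeeze_cvgr _ lo (Plim (0, 0) lf)); near=> n; apply/andP; split; last first.
  exact: minus_mean_le.
have h1 : minus_mean n g <= plus_mean n g by apply: minus_mean_le.
have h2 := EfD n (fun=> true); have h3 := EfD n (fun=> false).
by rewrite /d /plus_mean /minus_mean in h1 h2 h3 *; lra.
Unshelve. all: by end_near. Qed.

Lemma state_flip (f : config -> R) : vlocal f -> (forall s, 0 <= f s) -> increasing f ->
  P (f \o conf_neg) = P f.
Proof.
move=> lf f0 fi.
apply: (lim_uniq ((Plim (0, 0) (vlocal_neg lf)))).
have -> : (fun n => ising_mean beta (box_at (0, 0) n) (f \o conf_neg) (fun=> true)) =
  (fun n => minus_mean n f).
  by apply/funext => n; rewrite minus_mean_neg.
exact: minus_limit.
Qed.

(** Whatever the spins outside a box, the minus boundary condition is the worst case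
    for an increasing function inside. *)
Lemma state_outside k (a f : config -> R) : vlocal a -> vlocal f -> (forall s, 0 <= a s) ->
  (forall s, 0 <= f s) -> increasing f -> indep (box_at (0, 0) k) a ->
  minus_mean k f * P a <= P (fun s => a s * f s).
Proof.
move=> la lf a0 f0 fi ia; rewrite -stateZ //.
apply: state_le; [exact: vlocal_comp la | exact: (vlocal_comp2 (fun a b => a * b)) |].
near=> n.
rewrite /plus_mean [leRHS](ising_mean_tower beta f _ (box_at_uniq (0, 0) k) (box_at_uniq (0, 0)
  n) _ ia).
  apply: gibbs_le; first exact: ising_weight_gt0.
  move=> t _; rewrite mulrC; apply: ler_wpM2l => //.
  by apply: ising_mean_monotone.
move=> x; rewrite !mem_box_at => h; apply: (leq_trans h); near: n; exact: nbhs_infty_ge.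
Unshelve. all: by end_near. Qed.

Definition column_state (g : pred col -> R) : R := P (fun s => g (majority s)).

Let ind (A : pred col -> Prop) : config -> R := fun s => (`[< A (majority s) >])%:R.

Let ind_local A : flocal A -> vlocal (ind A).
Proof. by move=> lA; apply: (vlocal_majority (flocal_ind R lA)). Qed.

Let ind_ge0 A s : 0 <= ind A s. Proof. exact: ler0n. Qed.

Let ind_incr A : increasing_event A -> increasing (ind A).
Proof.
move=> iA s t st; rewrite ler_nat; case: asboolP => //= As.
by case: asboolP => // nA; case: nA; apply: iA As; apply: majority_le.
Qed.

Let ind_and A B : ind (fun t => A t /\ B t) = (fun s => ind A s * ind B s).
Proof.
apply/funext => s; rewrite /ind -natrM mulnb; congr (nat_of_bool _)%:R.
by apply/asboolP/andP => [[? ?]|[/asboolP ? /asboolP ?]]; split=> //; apply/asboolP.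
Qed.

Let ind_indep n A : box_free n A -> indep (box_at (0, 0) n) (ind A).
Proof.
move=> fA s x b; rewrite mem_box_at => xn.
have h c : (n < cnorm c)%N -> majority (upd s x b) c = majority s c.
  move=> nc; apply: majority_eq => k; rewrite /upd; case: eqP => // e.
  move: xn nc; rewrite -e /untranslate /= !subr0; case: (c) => ? ? /=.
  by rewrite ltnNge => ->.
congr (nat_of_bool _)%:R; apply/asboolP/asboolP; apply: fA => c hc; by rewrite h.
Qed.

(** Mixing and finite energy both come from [state_outside]: the minus mean of a local
    increasing function converges to its mean, and under minus boundary conditions
    the configuration that fills the box has a positive weight. *)
Lemma column_state_planar : planar_state column_state.
Proof.
split.
- by move=> c; apply: state_cst.
- by move=> f g lf lg; apply: stateD; apply: vlocal_majority.
- by move=> f g lf lg fg; apply: state_mono => //; apply: vlocal_majority.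
- move=> A B lA lB iA iB; rewrite /prob /column_state.
  have := ind_and A B; rewrite /ind => ->.
  by apply: state_fkg => //; [exact: ind_local|exact: ind_local|exact: ind_incr|exact: ind_incr].
- move=> A v lA; exact: (state_translate v (ind_local lA)).
- move=> A lA.
  apply: (@state_column_sym _ turn (iter 3 turn) (ind_local lA)).
  + by move=> c; apply: turn4.
  + by move=> c; apply: turn4.
  + exact: turn_adj.
  + by move=> c d h; apply: (iter_turn_adj 3).
  + exact: turn_norm.
- move=> A lA.
  apply: (@state_column_sym _ mirror mirror (ind_local lA)).
  + exact: mirrorK.
  + exact: mirrorK.
  + exact: mirror_adj.
  + exact: mirror_adj.
  + exact: mirror_norm.
- move=> A lA iA; rewrite /prob /column_state.
  have -> : (fun s => (`[< A (predC (majority s)) >])%:R) = ind A \o conf_neg.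
    by apply/funext => s; rewrite /ind /= majority_neg.
  by apply: state_flip; [exact: ind_local|by []|exact: ind_incr].
- move=> A e lA iA e0.
  have := minus_limit (ind_local lA) (ind_ge0 A) (ind_incr iA).
  move=> /cvgrPdist_lt /(_ _ e0) [k _ hk].
  exists k => D lD fD; rewrite /prob /column_state.
  have := ind_and D A; rewrite /ind => ->.
  apply: le_trans (_ : minus_mean k (ind A) * P (ind D) <= _); last first.
    by apply: state_outside => //; [exact: ind_local|exact: ind_local|exact: ind_incr|exact:
      ind_indep].
  rewrite mulrC; apply: ler_wpM2r.
    by rewrite -(state_cst 0); apply: state_mono => //; [exact: vlocal_cst|exact: ind_local].
  have := hk k (leqnn k); rewrite /= ltr_norml => /andP[_].
  by rewrite -/(ind A); lra.
- move=> n; have lF := flocal_full n.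
  have iF : increasing_event (full_box n) by move=> t t' tt' h c hc; apply: tt'; apply: h.
  exists (minus_mean n (ind (full_box n))).
    rewrite /minus_mean /ising_mean /gibbs divr_gt0 //; last by apply: conf_sum_gt0;
      exact: ising_weight_gt0.
    pose tau : config := fun x => x \in box_at (0, 0) n.
    apply: (@lt_le_trans _ _ (ind (full_box n) tau * ising_weight beta (box_at (0, 0) n) tau)).
      rewrite mulr_gt0 ?ising_weight_gt0 // /ind; case: asboolP => // nf; case: nf => c hc.
      have ct k : tau (c, k).
        by rewrite /tau mem_box_at /untranslate /= !subr0; case: (c) hc.
      by rewrite majorityE !ct.
    apply: (conf_sum_ge_term (F := fun t => ind (full_box n) t * ising_weight beta (box_at (0,
      0) n) t)).
      by move=> t; rewrite mulr_ge0 // ltW // ising_weight_gt0.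
    by move=> x; rewrite /tau => /negbTE.
  move=> D lD fD; rewrite /prob /column_state.
  have := ind_and D (full_box n); rewrite /ind => ->.
  by apply: state_outside => //; [exact: ind_local|exact: ind_local|exact: ind_incr|exact:
    ind_indep].
Qed.

End unmagnetized.

Lemma percolation_magnetized theta : 0 < theta ->
  (forall N, theta <= P (fun s => (`[< reaches N (majority s) >])%:R)) ->
  P (up origin) <> 2^-1.
Proof.
move=> th0 h half.
exact: (no_percolation (column_state_planar half) th0 h).
Qed.

End plus_state.

(** * Exploration from outside *)

Definition outer (N : nat) (t : pred col) : pred col := fun c =>
  `[< exists2 y, cnorm y = N & conn (fun c => t c && (cnorm c <= N)%N) c y >].

Definition unexplored (N : nat) (t : pred col) : pred col := fun c =>
  [&& (cnorm c < N)%N, ~~ outer N t c & ~~ `[< exists2 d, col_adj c d & outer N t d >]].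

Lemma outer_ring N (t : pred col) c : cnorm c = N -> t c -> outer N t c.
Proof.
by move=> cN tc; apply/asboolP; exists c => //; apply: conn_refl; rewrite tc cN leqnn.
Qed.

Lemma outer_step N (t : pred col) c d : outer N t d -> col_adj c d -> (cnorm c <= N)%N -> t c ->
  outer N t c.
Proof.
move=> /asboolP[y yN cy] cd cN tc; apply/asboolP; exists y => //.
apply: conn_trans (cy); apply: conn_edge => //; first by rewrite tc cN.
by have [] := conn_in cy.
Qed.

Lemma unexplored_boundary N (t : pred col) c d : unexplored N t c -> col_adj c d ->
  ~~ unexplored N t d -> ~~ t d.
Proof.
move=> /and3P[cN nc nn] cd nd; apply/negP => td.
have nod : ~~ outer N t d.
  by apply/negP => od; case/negP: nn; apply/asboolP; exists d.
have dN : (cnorm d <= N)%N by apply: leq_trans (cnorm_adj cd) _.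
have [e|lt] : cnorm d = N \/ (cnorm d < N)%N by clear - dN; lia.
  by case/negP: nod; apply: outer_ring.
move: nd; rewrite /unexplored lt nod /= negbK => /asboolP[e de oe].
by case/negP: nod; apply: outer_step oe de _ td.
Qed.

Lemma outer_explored N (t : pred col) c : outer N t c -> ~~ unexplored N t c.
Proof. by move=> oc; rewrite /unexplored oc /= andbF. Qed.

Lemma ring_explored N (t : pred col) c : cnorm c = N -> ~~ unexplored N t c.
Proof. by move=> cN; rewrite /unexplored cN ltnn. Qed.

Lemma near_outer_explored N (t : pred col) c d : col_adj c d -> outer N t d -> ~~ unexplored N t c.
Proof.
move=> cd od; rewrite /unexplored; apply/negP => /and3P[_ _ /negP]; apply.
by apply/asboolP; exists d.
Qed.

(** A path from the ring cannot enter the unexplored region: its first column there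
    would be a neighbour of an explored plus cluster. *)
Lemma unexplored_stable N (t t' : pred col) :
  (forall c, ~~ unexplored N t c -> t c = t' c) -> unexplored N t' = unexplored N t.
Proof.
move=> tt'.
suff oE c : outer N t' c = outer N t c.
  apply/funext => c; rewrite /unexplored oE; congr [&& _, _ & ~~ _].
  by apply/asboolP/asboolP => -[d cd od]; exists d; rewrite // ?oE // -oE.
apply/idP/idP => /asboolP[y yN /conn_sym cy].
  apply: (conn_ind (P := fun d => outer N t d) cy).
    have /andP[ty _] := (conn_in cy).1.
    by apply: outer_ring => //; rewrite tt' // ring_explored.
  move=> u v _ /andP[tv vN] /col_adj_sym vu ou.
  by apply: (outer_step ou vu vN); rewrite tt' //; apply: near_outer_explored vu ou.
apply/asboolP; exists y => //; apply: conn_sym; apply: (conn_avoid cy) => v cv.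
have /andP[tv vN] := (conn_in cv).2.
rewrite -tt' ?tv //; apply: outer_explored; apply/asboolP; exists y => //.
exact: conn_sym.
Qed.

Section exploration.
Variables (R : realType) (beta : R).
Hypothesis beta0 : 0 <= beta.

(** For a column with at most one plus spin, the cyclic shift of the layers lies below
    the spin flip. So the kernel with shifted boundary condition is dominated by the
    kernel with flipped boundary condition: the probabilities of a plus spin in two
    consecutive layers add up to at most 1. *)
Lemma surrounded_column (D : seq col) (sigma : config) (c0 : col) :
  uniq D -> c0 \in D ->
  (forall c d, c \in D -> d \notin D -> col_adj c d -> ~~ majority sigma d) ->
  \sum_(k < 3) ising_mean beta (lift_cols D) (up R (c0, k)) sigma <= 3 / 2.
Proof.
move=> uD c0D bd; set L := lift_cols D.
(* sigma may have plus columns away from D; only its values next to D matter *)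
pose eta : config := fun x =>
  [&& sigma x, x.1 \notin D & has (fun c => col_adj c x.1) D].
have EE k : ising_mean beta L (up R (c0, k)) sigma = ising_mean beta L (up R (c0, k)) eta.
  apply: (@gibbs_depends _ (fun x => x \in L \/ exists2 y, y \in L & adj x y)).
  - move=> s t st; rewrite /up st //; left; by rewrite mem_lift_cols.
  - exact: ising_weight_depends.
  - move=> x [-> //|[y yL xy]]; rewrite mem_lift_cols => xD.
    rewrite /eta xD /=; move: yL; rewrite mem_lift_cols => yD.
    have -> : has (fun c => col_adj c x.1) D.
      apply/hasP; exists y.1 => //; move: xy xD yD.
      case: x y => [c k'] [d l]; rewrite adjE /= => /orP[/andP[/eqP -> _]|/andP[cd _]].
        by move=> /negP.
      by move=> _ _; apply: col_adj_sym.
    by rewrite andbT.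
pose p k := ising_mean beta L (up R (c0, k)) eta.
pose g := vmap id (fun k : 'I_3 => k + 1).
pose g' := vmap id (fun k : 'I_3 => k - 1).
have gK : cancel g g' by case=> c k; rewrite /g /g' /vmap /= addrK.
have g'K : cancel g' g by case=> c k; rewrite /g /g' /vmap /= subrK.
have ga x y : adj (g x) (g y) = adj x y.
  by apply: adj_vmap => //; apply: addIr.
have gL : L =i map g L.
  move=> x; rewrite -[in RHS](g'K x) (mem_map (can_inj gK)) !mem_lift_cols.
  by case: x.
have uL : uniq L by apply: lift_cols_uniq.
have ugL : uniq (map g L) by rewrite map_inj_uniq //; exact: can_inj gK.
have pk k : p (k + 1) + p k <= 1.
  have e1 : p (k + 1) = ising_mean beta L (up R (c0, k)) (pullback g eta).
    rewrite -(ising_mean_pullback beta L (up R (c0, k)) eta gK g'K ga) /p /ising_mean.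
    have e : gibbs L (ising_weight beta L) (up R (c0, k + 1)) eta =
        gibbs (map g L) (ising_weight beta L) (up R (c0, k + 1)) eta.
      exact: (congr1 (fun F : config -> R => F eta) (gibbs_mem (ising_weight beta L) (up R (c0,
        k + 1)) uL ugL gL)).
    have wE : ising_weight beta L = ising_weight beta (map g L).
      apply/funext => s; rewrite /ising_weight; have -> // : [set` L] = [set` map g L].
      by apply/seteqP; split=> x /=; rewrite gL.
    by rewrite -wE; apply: e.
  have le : conf_le (pullback g eta) (conf_neg eta).
    move=> [d l]; rewrite /pullback /g /vmap /conf_neg /eta /=.
    move=> /and3P[s1 dD hd]; rewrite dD hd !andbT.
    have [c cD cd] := hasP hd.
    have := bd c d cD dD cd; rewrite majorityE; apply: contra.
    move: s1; case: l => -[|[|[|//]]] hl /=.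
    - have -> : Ordinal hl + 1 = inord 1 by apply: val_inj; rewrite /= inordK.
      have -> : Ordinal hl = ord0 by apply: val_inj.
      by move=> -> ->.
    - have -> : Ordinal hl + 1 = inord 2 by apply: val_inj; rewrite /= inordK.
      have -> : Ordinal hl = inord 1 by apply: val_inj; rewrite /= inordK.
      by move=> -> ->; rewrite !orbT.
    - have -> : Ordinal hl + 1 = ord0 by apply: val_inj.
      have -> : Ordinal hl = inord 2 by apply: val_inj; rewrite /= inordK.
      by move=> -> ->; rewrite !orbT.
  have e2 : ising_mean beta L (up R (c0, k)) (conf_neg eta) = 1 - p k.
    rewrite -ising_mean_neg; apply/eqP; rewrite eq_sym subr_eq eq_sym; apply/eqP.
    rewrite /p -gibbsD -[RHS](@gibbs_cst _ _ (ising_weight_gt0 beta L) L 1 eta).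
    congr gibbs; apply/funext => s; rewrite /up /= /conf_neg.
    by case: (s _); rewrite ?addr0 ?add0r.
  rewrite e1 -lerBrDr -e2; apply: ising_mean_monotone => //.
  by move=> s t st; rewrite /up ler_nat; have := st (c0, k); case: (s _) => // ->.
have -> : \sum_(k < 3) ising_mean beta L (up R (c0, k)) sigma = \sum_(k < 3) p k.
  by apply: eq_bigr => k _; rewrite EE.
have s2 : \sum_(k < 3) p (k + 1) = \sum_(k < 3) p k.
  rewrite [RHS](reindex_inj (h := fun k : 'I_3 => k + 1)) //; exact: addIr.
have : \sum_(k < 3) (p (k + 1) + p k) <= \sum_(k < 3) 1.
  by apply: ler_sum => k _; apply: pk.
by rewrite big_split /= s2 sumr_const card_ord; lra.
Qed.

Definition column_excess (sigma : config) : R :=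
  \sum_(k < 3) up R ((0, 0), k) sigma - 3 / 2.

Lemma column_excess_kernel L sigma : ising_mean beta L column_excess sigma =
  \sum_(k < 3) ising_mean beta L (up R ((0, 0), k)) sigma - 3 / 2.
Proof.
rewrite /ising_mean /column_excess gibbsD gibbs_cst; last exact: ising_weight_gt0.
by congr (_ - _); apply: gibbs_sum; exact: ising_weight_gt0.
Qed.

Lemma column_excess_minus sigma : ~~ majority sigma (0, 0) -> column_excess sigma <= 0.
Proof.
rewrite majorityE /column_excess /up sum_layers.
by case: (sigma _); case: (sigma _); case: (sigma _) => //= _; lra.
Qed.

Lemma column_excess_le sigma : column_excess sigma <= 3 / 2.
Proof.
rewrite /column_excess /up sum_layers.
by case: (sigma _); case: (sigma _); case: (sigma _) => /=; lra.
Qed.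

Lemma majority_upd sigma x b c : c != x.1 -> majority (upd sigma x b) c = majority sigma c.
Proof.
move=> cx; apply: majority_eq => k; rewrite /upd; case: eqP => // e.
by rewrite -e eqxx in cx.
Qed.

(** Decompose according to the unexplored region. On each value of it that contains
    the origin, conditioning on the explored spins gives a nonpositive mean. Otherwise
    the origin is in a minus column or is joined to the ring. *)
Lemma finite_magnetization_bound (n N : nat) : (0 < N)%N -> (N <= n)%N ->
  ising_mean beta (box_at (0, 0) n) column_excess (fun=> true) <=
  ising_mean beta (box_at (0, 0) n)
    (fun s => 3 / 2 * (`[< reaches N (majority s) >])%:R) (fun=> true).
Proof.
move=> N0 Nn.
pose C := col_box N.
pose pattern (s : config) : (size C).-tuple bool :=
  [tuple of map (unexplored N (majority s)) (in_tuple C)].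
pose D (m : (size C).-tuple bool) : seq col := mask m C.
have DE s : D (pattern s) = [seq c <- C | unexplored N (majority s) c].
  by rewrite /D filter_mask.
have memD s c : (c \in D (pattern s)) = unexplored N (majority s) c.
  rewrite DE mem_filter mem_col_box; case: (boolP (unexplored _ _ _)) => // /and3P[h _ _].
  by rewrite ltnW.
have uD m : uniq (D m) by rewrite mask_uniq ?col_box_uniq.
pose at_ m (s : config) : R := (pattern s == m)%:R.
have patE s x b : x.1 \in D (pattern s) -> pattern (upd s x b) = pattern s.
  rewrite memD => ux; apply: val_inj => /=.
  rewrite (@unexplored_stable N (majority s)) // => c nc.
  by rewrite majority_upd //; apply: contraNneq nc => ->.
have at_indep m : indep (lift_cols (D m)) (at_ m).
  move=> s x b; rewrite mem_lift_cols => xm; congr (nat_of_bool _)%:R.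
  apply/eqP/eqP => e.
    by rewrite -e -{1}(upd_id s x) -(upd_same s x b) patE ?e.
  by rewrite patE e.
have decomp s : column_excess s <= 3 / 2 * (`[< reaches N (majority s) >])%:R +
    \sum_(m : (size C).-tuple bool) at_ m s * (((0, 0) \in D m)%:R * column_excess s).
  rewrite (bigD1 (pattern s)) //= big1 ?addr0; last first.
    by move=> m ms; rewrite /at_ eq_sym (negbTE ms) mul0r.
  rewrite /at_ eqxx mul1r memD.
  have -> : `[< reaches N (majority s) >] = outer N (majority s) (0, 0) by [].
  case: (boolP (outer N (majority s) (0, 0))) => o.
    rewrite (negbTE (outer_explored o)) mul0r addr0 mulr1; exact: column_excess_le.
  rewrite mulr0 add0r.
  case: (boolP (unexplored N (majority s) (0, 0))) => u; first by rewrite mul1r.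
  rewrite mul0r; apply: column_excess_minus; apply: contra (o) => m0.
  move: u; rewrite /unexplored (negbTE o) [(cnorm _ < N)%N]N0 /=.
  rewrite negbK => /asboolP[d ad od].
  by case/negP: (o); apply: (outer_step od ad).
apply: (le_trans (gibbs_le (ising_weight_gt0 beta (box_at (0, 0) n)) (fun t _ => decomp t))).
rewrite gibbsD gerDl gibbs_sum; last exact: ising_weight_gt0.
apply: sumr_le0 => m _.
case: (boolP ((0, 0) \in D m)) => [om|_]; last first.
  have -> : (fun t => at_ m t * (false%:R * column_excess t)) = (fun=> 0).
    by apply/funext => t; rewrite mul0r mulr0.
  by rewrite gibbs_cst //; exact: ising_weight_gt0.
have -> : (fun t => at_ m t * (true%:R * column_excess t)) = (fun t => at_ m t * column_excess t).
  by apply/funext => t; rewrite mul1r.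
rewrite -/(ising_mean beta _ _ _) (ising_mean_tower beta column_excess _ (lift_cols_uniq (uD
  m)) (box_at_uniq (0, 0) n) _ (at_indep m)).
  rewrite -[leRHS](@gibbs_cst _ _ (ising_weight_gt0 beta (box_at (0, 0) n)) (box_at (0, 0) n) 0
    (fun=> true)).
  apply: gibbs_le; first exact: ising_weight_gt0.
  move=> t _; rewrite /at_; case: eqP => [e|_]; last by rewrite mul0r.
  rewrite mul1r column_excess_kernel subr_le0; apply: surrounded_column => //.
  move=> c d; rewrite -e !memD => uc ud cd; exact: unexplored_boundary uc cd ud.
move=> x; rewrite mem_lift_cols mem_box_at => /mem_mask; rewrite mem_col_box.
rewrite /untranslate /= !subr0; case: (x.1) => ? ? /= h; exact: leq_trans h Nn.
Qed.

Lemma magnetization_bound (P : (config -> R) -> R) (N : nat) : is_plus_limit beta P ->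
  (0 < N)%N ->
  2 * P (up R origin) - 1 <= P (fun s => (`[< reaches N (majority s) >])%:R).
Proof.
move=> Plim N0.
have lr : vlocal (fun s => (`[< reaches N (majority s) >])%:R : R).
  exact: (vlocal_majority (flocal_ind R (flocal_reaches N))).
have lu k : vlocal (up R ((0, 0), k)) by apply: vlocal_up.
have PE : P column_excess = 3 * P (up R origin) - 3 / 2.
  rewrite /column_excess.
  have -> : (fun s => \sum_(k < 3) up R ((0, 0), k) s - 3 / 2) =
    (fun s => up R origin s +
      (up R ((0, 0), inord 1) s + (up R ((0, 0), inord 2) s + (- (3 / 2))))).
    by apply/funext => s; rewrite sum_layers !addrA.
  have l0 : vlocal (fun=> - (3 / 2) : R) by apply: vlocal_cst.
  rewrite !(stateD Plim) ?(state_cst Plim) //; try exact: lu;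
    try by do ?apply: (vlocal_comp2 +%R); try exact: lu.
  by rewrite !(state_up Plim); lra.
have : P column_excess <= P (fun s => 3 / 2 * (`[< reaches N (majority s) >])%:R).
  apply: (state_le Plim).
  - apply: (vlocal_comp (fun y => y - 3 / 2)).
    rewrite /vlocal; exists [seq ((0, 0), k) | k <- enum 'I_3] => s t st.
    apply: eq_bigr => k _; rewrite /up st //; apply: map_f; exact: mem_enum.
  - exact: (vlocal_comp (fun y => 3 / 2 * y) lr).
  - near=> n; apply: finite_magnetization_bound => //; near: n; exact: nbhs_infty_ge.
by rewrite PE (stateZ Plim) //; lra.
Unshelve. all: by end_near. Qed.

End exploration.

(** * From the measure to the plus state *)

Lemma vlocal_measurable (A : set config) : vlocal (A : config -> Prop) ->
  measurable (A : set Sigma3).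
Proof.
move=> [K]; elim: K A => [|x K IH] A hA.
  have [a|na] := pselect (A (fun=> true)).
    have -> : A = setT by apply/seteqP; split=> // s _; rewrite (hA s (fun=> true)).
    exact: measurableT.
  have -> : A = set0 by apply/seteqP; split=> // s As; apply: na; rewrite -(hA s).
  exact: measurable0.
have mx b : measurable ([set s | s x = b] : set Sigma3).
  apply: sub_sigma_algebra; exists [:: x], (fun=> b); apply/seteqP; split=> s /=.
    by move=> sx y; rewrite inE => /eqP ->.
  by apply; rewrite mem_head.
have mA b : measurable ([set s | A (upd s x b)] : set Sigma3).
  apply: IH => s t st; apply: hA => y; rewrite inE /upd.
  by case: (y == x) => // /st.
have -> : A = ([set s | s x = true] `&` [set s | A (upd s x true)]) `|`
             ([set s | s x = false] `&` [set s | A (upd s x false)]).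
  apply/seteqP; split=> s /=.
    move=> As; case sx : (s x); [left|right]; split=> //; by rewrite -sx upd_id.
  by case=> -[sx]; rewrite -sx upd_id.
by apply: measurableU; apply: measurableI.
Qed.

Section local_functions.
Variables (R : realType) (mu : probability Sigma3 R).
Implicit Type f : config -> R.

Lemma vlocal_bounded f : vlocal f -> exists M, forall s, `|f s| <= M.
Proof.
move=> [K hK]; exists (conf_sum K (fun s => `|f s|) (fun=> true)) => s.
apply: (le_trans (conf_sum_ge_term (F := fun s => `|f s|) (L := K) (sigma := s) _ _)) => //.
rewrite (@conf_sum_depends _ (fun x => x \in K) K _ s (fun=> true)) //.
- by move=> u v uv; rewrite (hK u v).
- by move=> x ->.
Qed.

Lemma vlocal_expectation_fin f : vlocal f -> ('E_mu[f : Sigma3 -> R])%E \is a fin_num.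
Proof.
move=> lf; have [M hM] := vlocal_bounded lf.
rewrite unlock; apply: integrable_fin_num => //.
apply: measurable_bounded_integrable => //.
- by apply: fin_num_fun_lty; exact: fin_num_measure.
- move=> _ Y mY; rewrite setTI.
  exact: (vlocal_measurable (vlocal_comp (fun y => Y y) lf)).
- exists M; split; first exact: num_real.
  by move=> y My s _; apply: le_trans (hM s) _; apply: ltW.
Qed.

Lemma vlocal_expectation_ind (A : set config) : vlocal (A : config -> Prop) ->
  ('E_mu[(fun s => (`[< A s >])%:R) : Sigma3 -> R])%E = mu A.
Proof.
move=> lA; rewrite -(expectation_indic mu (vlocal_measurable lA)).
by congr expectation; apply/funext => s; rewrite indicE.
Qed.

Lemma vlocal_continuous f : vlocal f -> continuous (f : {ptws vertex -> bool} -> R).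
Proof.
move=> [K hK] s A As.
have near_agree : nbhs (s : {ptws vertex -> bool})
    [set t : {ptws vertex -> bool} | forall x, x \in K -> t x = s x].
  elim: (K) => [|x L IH].
    by apply: filterS filterT => t _ y.
  have hx : nbhs (s : {ptws vertex -> bool}) [set t : {ptws vertex -> bool} | t x = s x].
    apply: (@proj_continuous vertex (fun=> bool) x s [set b | b = s x]).
    exact: discrete_set1.
  apply: filterS (filterI hx IH) => t /= [tx tL] y; rewrite inE => /orP[/eqP -> //|].
  exact: tL.
apply: filterS near_agree => t ht /=; rewrite (hK t s) //; exact: nbhs_singleton.
Qed.

End local_functions.

Definition act (s : bool) (sigma : config) : config := if s then sigma else conf_neg sigma.

Lemma vlocal_act (V : Type) s (f : config -> V) : vlocal f -> vlocal (fun t => f (act s t)).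
Proof.
case: s => // -[K hK]; exists K => u v uv; apply: hK => x xK.
by rewrite /= /conf_neg uv.
Qed.

Lemma signed_colsE s sigma c : signed_cols s sigma c <-> majority (act s sigma) c.
Proof.
case: s => //=; rewrite /majority; suff -> : col_sum (conf_neg sigma) c = - col_sum sigma c.
  by rewrite oppr_gt0.
rewrite /col_sum -sumrN; apply: eq_bigr => k _; rewrite /conf_neg.
by case: (sigma _).
Qed.

(** The cluster of the origin is infinite as soon as it has a column at every distance. *)
Lemma percolatesE s :
  percolates s = \bigcap_N [set sigma | reaches N (majority (act s sigma))].
Proof.
apply/seteqP; split=> sigma.
  move=> [C [[sC cC _] C0 iC]] N _.
  have [c Cc cN] : exists2 c, C c & (N < cnorm c)%N.
    apply: contrapT => nh; apply: iC.
    apply: (@sub_finite_set _ _ [set` col_box N]); last exact: finite_seq.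
    move=> c Cc /=; rewrite mem_col_box leqNgt; apply/negP => cN.
    by apply: nh; exists c.
  have [p [pp lp ap]] := cC _ _ C0 Cc.
  have cp : conn (majority (act s sigma)) (0, 0) c.
    exists p; split=> //; apply/allP => d; rewrite inE => /orP[/eqP ->|dp].
      exact/signed_colsE/sC.
    exact/signed_colsE/sC/ap.
  have [||z zN cz] := conn_ring (N := N) cp; [by []|exact: ltnW|].
  by exists z.
move=> h; pose T := majority (act s sigma).
have cTn N : exists2 y, cnorm y = N & conn T (0, 0) y.
  have [y yN c] := h N I; exists y => //.
  by apply: conn_sub c => z /andP[].
have T0 : T (0, 0) by have [y _ /conn_in[]] := cTn 0%N.
exists [set c | conn T (0, 0) c]; split.
- split.
  + by move=> c /conn_in[_ Tc]; apply/signed_colsE.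
  + move=> c d /= c0 d0.
    have cd := conn_trans (conn_sym c0) d0.
    have [p [pp lp ap]] : conn (fun e => `[< conn T (0, 0) e >]) c d.
      apply: (conn_avoid cd) => v cv; apply/asboolP; exact: conn_trans c0 cv.
    by exists p; split=> // e ep; apply/asboolP; apply: (allP ap); rewrite inE ep orbT.
  + move=> D sD cD CD; apply/seteqP; split=> // d Dd /=.
    have [p [pp lp ap]] := cD _ _ (CD (0, 0) (conn_refl T0)) Dd.
    exists p; split=> //; apply/allP => e; rewrite inE => /orP[/eqP ->//|ep].
    exact/signed_colsE/sD/ap.
- exact: conn_refl.
- move=> fC.
  have : finite_set (cnorm @` [set c | conn T (0, 0) c]) by apply: finite_image.
  have -> : cnorm @` [set c | conn T (0, 0) c] = setT.
    apply/seteqP; split=> // N _; have [y yN c] := cTn N.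
    by exists y.
  exact: infinite_nat.
Qed.

Section main.
Variables (R : realType) (beta : R) (s : bool) (mu : probability Sigma3 R).
Hypotheses (beta0 : 0 <= beta) (mu_s : is_ising_state beta s mu).

Lemma sqbox_cvg v : sqbox v n @[n --> \oo] --> boxes_to_Z2.
Proof.
move=> A [n _ hA]; exists (n + cnorm v)%N => // m /= hm; apply: hA => /=.
move=> [a b]; rewrite /in_box /centered_box /sqbox /=; case: v hm => v1 v2.
by rewrite /cnorm /=; clear; lia.
Qed.

(** Expectations after a global flip when the boundary condition is minus, which makes
    it the plus state in both cases. *)
Definition signed_state (f : config -> R) : R :=
  fine ('E_mu[(fun sigma => f (act s sigma)) : Sigma3 -> R])%E.

Lemma signed_state_limit : is_plus_limit beta signed_state.
Proof.
move=> f v lf; have lg := vlocal_act s lf.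
pose g sigma := f (act s sigma).
have hb : exists M : R, forall sigma, `|g sigma| <= M by apply: vlocal_bounded.
have := cvg_comp _ _ (@sqbox_cvg v) (mu_s (vlocal_continuous lg) hb).
rewrite -(fineK (vlocal_expectation_fin mu lg)) => /fine_cvgP[_].
have -> // : fine \o ((fun B => (ising_expectation beta s B g)%:E) \o sqbox v) =
  (fun n => ising_mean beta (box_at v n) f (fun=> true)).
apply/funext => n /=; rewrite ising_expectationE /g.
case: (s) => //; rewrite -[LHS]/(ising_mean beta (box_at v n) (f \o conf_neg) (fun=> false))
  ising_mean_neg.
by congr (ising_mean _ _ _ _); apply/funext.
Qed.

Lemma signed_state_up_ge : 2^-1 <= signed_state (up R origin).
Proof.
have h := signed_state_limit (0, 0) (vlocal_up R origin).
apply: (ler_cvg_to (cvg_cst (2^-1 : R)) h); near=> n.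
have h1 := @minus_mean_up R beta n origin.
have h2 := @minus_mean_le R beta beta0 n (up R origin).
have {h2} h2 : ising_mean beta (box_at (0, 0) n) (up R origin) (fun=> false) <=
    ising_mean beta (box_at (0, 0) n) (up R origin) (fun=> true).
  apply: h2 => [t|t u tu]; first exact: ler0n.
  by rewrite /up ler_nat; have := tu origin; case: (t _) => // ->.
by move: h1 h2; lra.
Unshelve. all: by end_near. Qed.

Lemma magnetizationE : magnetization mu =
  (if s then 2 * signed_state (up R origin) - 1
   else - (2 * signed_state (up R origin) - 1))%:E.
Proof.
pose c : R := if s then 1 else -1.
have lim := signed_state_limit.
have lu := vlocal_up R origin.
have e : signed_state (fun t => c * (2 * up R origin t + (- 1))) =
    c * (2 * signed_state (up R origin) - 1).
  rewrite (stateZ lim); last exact: (vlocal_comp (fun y => 2 * y + (- 1)) lu).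
  rewrite (stateD lim) ?(stateZ lim) ?(state_cst lim) //;
    first exact: (vlocal_comp (fun y => 2 * y) lu).
  exact: vlocal_cst.
have -> : (if s then 2 * signed_state (up R origin) - 1
   else - (2 * signed_state (up R origin) - 1)) = c * (2 * signed_state (up R origin) - 1).
  by rewrite /c; case: (s); rewrite ?mul1r ?mulN1r.
rewrite -e /signed_state /magnetization.
have -> : (fun sigma => c * (2 * up R origin (act s sigma) + (- 1))) =
    (fun sigma => spin (sigma origin)).
  apply/funext => sigma; rewrite /c /up /act /conf_neg.
  by case: (s); case: (sigma _); rewrite /spin /=; lra.
rewrite fineK //; apply: vlocal_expectation_fin.
exact: (vlocal_comp (fun b : bool => spin b) (vlocal_at origin)).
Qed.

Definition reach_event (N : nat) : set Sigma3 :=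
  [set sigma | reaches N (majority (act s sigma))].

Lemma vlocal_reach N : vlocal (reach_event N : config -> Prop).
Proof. exact: (vlocal_act s (vlocal_majority (flocal_reaches N))). Qed.

Lemma measurable_reach N : measurable (reach_event N).
Proof. exact: (vlocal_measurable (vlocal_reach N)). Qed.

Lemma measure_reach N :
  mu (reach_event N) = (signed_state (fun t => (`[< reaches N (majority t) >])%:R))%:E.
Proof.
rewrite -(vlocal_expectation_ind mu (vlocal_reach N)) fineK //.
apply: vlocal_expectation_fin.
exact: (vlocal_comp (fun P : Prop => (`[< P >])%:R) (vlocal_reach N)).
Qed.

Lemma measurable_percolates : measurable (percolates s : set Sigma3).
Proof. by rewrite percolatesE; apply: bigcapT_measurable => N; apply: measurable_reach. Qed.

(** The percolation probability is the decreasing limit of the probabilities that the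
    origin is joined to distance [N], each of which is at least the magnetization. *)
Lemma percolation_iff_magnetization :
  (0 < percolation_probability s mu)%E <-> (0 < `|magnetization mu|)%E.
Proof.
have lim := signed_state_limit.
have mE : (0 < `|magnetization mu|)%E <-> signed_state (up R origin) <> 2^-1.
  rewrite magnetizationE abse_EFin lte_fin normr_gt0.
  have -> : ((if s then 2 * signed_state (up R origin) - 1
    else - (2 * signed_state (up R origin) - 1)) != 0) = (2 * signed_state (up R origin) - 1 != 0).
    by case: (s); rewrite ?oppr_eq0.
  split=> [/eqP h e|h]; first by apply: h; rewrite e; lra.
  by apply/eqP => e; apply: h; lra.
rewrite mE /percolation_probability; split=> [h|h].
  have fp : mu (percolates s) \is a fin_num by apply: fin_num_measure; apply: measurable_percolates.
  have t0 : 0 < fine (mu (percolates s)) by rewrite -lte_fin fineK.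
  apply: (percolation_magnetized beta0 lim t0) => N.
  rewrite -lee_fin -measure_reach fineK //; apply: le_measure.
  - by rewrite inE; apply: measurable_percolates.
  - by rewrite inE; apply: measurable_reach.
  - by rewrite percolatesE => sigma /(_ N I).
have d0 : 0 < 2 * signed_state (up R origin) - 1.
  have := signed_state_up_ge; rewrite le_eqVlt => /orP[/eqP e|]; first by case: h.
  by lra.
set d := 2 * _ - 1 in d0.
have dec N N' : (N <= N')%N -> reach_event N' `<=` reach_event N.
  move=> NN' sigma [y yN c].
  have [||z zN cz] := conn_ring (N := N) c; [by []|by rewrite yN|].
  by exists z => //; apply: conn_sub cz => u /andP[/andP[-> _] ->].
have dN N : (d%:E <= mu (reach_event N))%E.
  apply: (@le_trans _ _ (mu (reach_event N.+1))).
    by rewrite measure_reach lee_fin; apply: (magnetization_bound beta0 lim).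
  by apply: le_measure; rewrite ?inE; [exact: measurable_reach|exact: measurable_reach|exact: dec].
rewrite percolatesE; apply: (@lt_le_trans _ _ d%:E); first by rewrite lte_fin.
have cv : mu \o reach_event @ \oo --> mu (\bigcap_N reach_event N).
  apply: nonincreasing_cvg_mu.
  - by rewrite (le_lt_trans (probability_le1 mu (measurable_reach 0))) ?ltry.
  - exact: measurable_reach.
  - by apply: bigcapT_measurable => N; apply: measurable_reach.
  - by move=> N N' NN'; apply/subsetPset/dec.
rewrite -(cvg_lim _ cv) //; apply: lime_ge; first by apply/cvg_ex; eexists; exact: cv.
by near=> N; apply: dN.
Unshelve. all: by end_near. Qed.

End main.

Theorem theorem5p2 (R : realType) (beta : R) (beta_ge0 : 0 <= beta)
  (s : bool) (mu : probability Sigma3 R) (mu_s : is_ising_state beta s mu) :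
  (0 < percolation_probability s mu)%E <-> (0 < `|magnetization mu|)%E.
Proof. exact: percolation_iff_magnetization beta_ge0 mu_s. Qed.
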